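(* Given a preference matrix $M$ with $m$ rows and at least $m$ columns over a set $B$ of $n$ elements: (i) deciding whether a given element $x$ is avoidable can be done in $O(m^2\sqrt{m+n})$ time, and also in $O(m^3)$ time; (ii) listing all unavoidable elements can be done in $O(m^2 n\sqrt{m+n})$ time, and also in $O(m^5)$ time.
   Context: A preference matrix with $m$ rows is a matrix whose entries belong to a finite set $B$, $|B|=n$ (the elements, or houses), such that no row contains the same element twice. Each row represents the preference list of one applicant: within a row, an element further to the left is preferred to an element further to the right. A matching $\tau$ assigns to each row $r$ an element $\tau(r)$ occurring in row $r$, with distinct rows receiving distinct elements; its image set is denoted $s(\tau)$. A blocking coalition of $\tau$ is a non-empty set $A'$ of rows for which there is a matching $\tau'$ that differs from $\tau$ only on rows of $A'$ and such that every row of $A'$ gets in $\tau'$ an element strictly preferred (further to the left in that row) to the one it gets in $\tau$. A matching with no blocking coalition is a Pareto optimal matching (POM). An element $x$ is avoidable if there is a POM $\tau$ of $M$ with $x\notin s(\tau)$; it is unavoidable if $x\in s(\tau)$ for every POM $\tau$ of $M$. No POM selects a position beyond the first $m$ columns, so only the first $m$ columns of $M$ are considered (the relevant input is an $m\times m$ matrix). Time is measured in the usual unit-cost model. *)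

(* Defs.v *)
From HB Require Import structures.
From mathcomp Require Import all_boot all_order all_algebra.
From mathcomp Require Import reals.
Set Implicit Arguments.
Unset Strict Implicit.
Unset Printing Implicit Defensive.
Import Order.TTheory GRing.Theory Num.Theory.

(** * Preference matrices and Pareto optimal matchings *)

Section Preferences.

Variables (B : finType) (m l : nat) (M : 'M[B]_(m, l)).

Definition preference_matrix : bool := [forall r, injectiveb (M r)].

Definition matching (tau : {ffun 'I_m -> B}) : bool :=
  injectiveb tau && [forall r, exists j, M r j == tau r].

Definition prefers (r : 'I_m) (b c : B) : bool :=
  [exists j : 'I_l, exists k : 'I_l, [&& j < k, M r j == b & M r k == c]].

Definition blocking_coalition
    (tau : {ffun 'I_m -> B}) (A : {set 'I_m}) : bool :=
  (A != set0) &&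
  [exists tau' : {ffun 'I_m -> B},
    [&& matching tau',
        [forall r, (r \notin A) ==> (tau' r == tau r)]
      & [forall r in A, prefers r (tau' r) (tau r)]]].

Definition pom (tau : {ffun 'I_m -> B}) : bool :=
  matching tau && ~~ [exists A, blocking_coalition tau A].

Definition selected (tau : {ffun 'I_m -> B}) : {set B} :=
  [set tau r | r : 'I_m].

Definition avoidable (x : B) : bool :=
  [exists tau, pom tau && (x \notin selected tau)].

Definition unavoidable (x : B) : bool :=
  [forall tau, pom tau ==> (x \in selected tau)].

End Preferences.

(** * Unit-cost random access machine

   Programs are finite pieces of syntax acting on scalar registers and
   zero-initialised arrays of natural numbers.  The names of registers and
   arrays are literals, so a program uses finitely many of them and the arrays
   can be interleaved in a single memory with constant overhead.  Addition,
   truncated subtraction and comparison are the only arithmetic: at unit cost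
   on unbounded integers, multiplication would make the model unrealistically
   strong. *)

Inductive expr : Type :=
  | Cst of nat
  | Reg of nat
  | Get of nat & expr
  | Add of expr & expr
  | Sub of expr & expr
  | Ltn of expr & expr
  | Eqn of expr & expr.

Inductive program : Type :=
  | Skip
  | Set_ of nat & expr
  | Put of nat & expr & expr
  | Seq of program & program
  | If of expr & program & program
  | While of expr & program.

Record state := State {
  reg : nat -> nat;
  arr : nat -> nat -> nat
}.

Definition set_reg (s : state) (x v : nat) : state :=
  State (fun y => if y == x then v else reg s y) (arr s).

Definition set_arr (s : state) (a i v : nat) : state :=
  State (reg s)
    (fun b j => if (b == a) && (j == i) then v else arr s b j).

Fixpoint eval (s : state) (e : expr) : nat :=
  match e with
  | Cst k => k
  | Reg x => reg s x
  | Get a e1 => arr s a (eval s e1)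
  | Add e1 e2 => eval s e1 + eval s e2
  | Sub e1 e2 => eval s e1 - eval s e2
  | Ltn e1 e2 => eval s e1 < eval s e2
  | Eqn e1 e2 => eval s e1 == eval s e2
  end.

Fixpoint cost (e : expr) : nat :=
  match e with
  | Cst _ | Reg _ => 1
  | Get _ e1 => (cost e1).+1
  | Add e1 e2 | Sub e1 e2 | Ltn e1 e2 | Eqn e1 e2 => (cost e1 + cost e2).+1
  end.

(* [exec p s t s']: started in [s], [p] halts in [s'] after [t] time units. *)
Inductive exec : program -> state -> nat -> state -> Prop :=
  | ExecSkip s : exec Skip s 1 s
  | ExecSet s x e :
      exec (Set_ x e) s (cost e).+1 (set_reg s x (eval s e))
  | ExecPut s a e1 e2 :
      exec (Put a e1 e2) s (cost e1 + cost e2).+1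
           (set_arr s a (eval s e1) (eval s e2))
  | ExecSeq p q s t1 s1 t2 s2 :
      exec p s t1 s1 -> exec q s1 t2 s2 -> exec (Seq p q) s (t1 + t2) s2
  | ExecIfTrue e p q s t s' :
      eval s e != 0 -> exec p s t s' ->
      exec (If e p q) s ((cost e).+1 + t) s'
  | ExecIfFalse e p q s t s' :
      eval s e = 0 -> exec q s t s' ->
      exec (If e p q) s ((cost e).+1 + t) s'
  | ExecWhileTrue e p s t1 s1 t2 s2 :
      eval s e != 0 -> exec p s t1 s1 -> exec (While e p) s1 t2 s2 ->
      exec (While e p) s ((cost e).+1 + t1 + t2) s2
  | ExecWhileFalse e p s :
      eval s e = 0 -> exec (While e p) s (cost e).+1 s.

(** * Algorithmic problems on preference matrices *)

(* Elements of [B] are represented by their rank in [0, #|B|). *)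
Definition code (B : finType) (x : B) : nat := enum_rank x.

(* Registers 0, 1, 2 hold the numbers of rows, elements and columns, register 3
   holds [arg]; array 0 holds the entries of [M] in row-major order, [M i j]
   being in cell [i * l + j].  Everything else is 0. *)
Definition input (B : finType) (m l : nat) (M : 'M[B]_(m, l)) (arg : nat) :
    state :=
  State (nth 0 [:: m; #|B|; l; arg])
    (fun a => if a == 0
              then nth 0 [seq code (M i j) | i <- enum 'I_m, j <- enum 'I_l]
              else fun _ => 0).

Local Open Scope ring_scope.

(* For [0 < m] the bounds [T m n] of interest are at least 1, so that the
   additive constant is absorbed by [C]; it accounts for [m = 0], where they
   vanish although no program halts in time 0. *)
Definition decides_avoidable_in (R : realType)
    (T : nat -> nat -> R) (p : program) : Prop :=
  exists C : R,
    forall (B : finType) (m l : nat) (M : 'M[B]_(m, l)) (x : B),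
      (m <= l)%N -> preference_matrix M ->
      exists (t : nat) (s : state),
        [/\ exec p (input M (code x)) t s,
            t%:R <= C * (T m #|B| + 1)
          & reg s 0 = avoidable M x].

(* The output list is in array 1 and its length in register 0. *)
Definition lists_unavoidable_in (R : realType)
    (T : nat -> nat -> R) (p : program) : Prop :=
  exists C : R,
    forall (B : finType) (m l : nat) (M : 'M[B]_(m, l)),
      (m <= l)%N -> preference_matrix M ->
      exists (t : nat) (s : state),
        [/\ exec p (input M 0) t s,
            t%:R <= C * (T m #|B| + 1)
          & perm_eq (mkseq (arr s 1) (reg s 0))
                    [seq code x | x <- enum B & unavoidable M x]].

(* Main.v *)
Require Import Defs.
From HB Require Import structures.
From mathcomp Require Import all_boot all_order all_algebra.
From mathcomp Require Import reals zify lra.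
Import Order.TTheory GRing.Theory Num.Theory.
Set Implicit Arguments.
Unset Strict Implicit.
Unset Printing Implicit Defensive.

(** An element [x] is avoidable iff the rows can be matched with distinct
    elements that precede [x], only the first [m] columns being used.  Given
    such a matching, one of minimal total rank is Pareto optimal; conversely a
    row that ranked the free element [x] above its own would block on its own.

    The matching problem is solved in time [O(m^2 sqrt m)] by an auction
    followed by augmenting paths.  In the auction an unmatched row takes a
    cheapest element of its list, evicting the owner, and raises the price by
    one; it gives up when all its elements cost at least [k], where [k] is
    [sqrt m] rounded up.  Each bid takes [O(m)] time and there are at most
    [k m] of them.  If a perfect matching exists, at most [m / (k + 1)] rows
    have given up, and each of these is matched by a breadth-first search in
    time [O(m^2)].

    An element that is not chosen when the rows pick their favourite free
    element one after the other is avoidable, so that only [m] candidates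
    have to be tested to list the unavoidable elements.  The resulting bounds
    [O(m^2 sqrt m)] and [O(m^3 sqrt m)] imply all four claims, since [m <= n]
    unless [m = 0]. *)

(** * Timed program logic *)

Definition runs (p : program) (s : state) (T : nat) (Q : state -> Prop) : Prop :=
  exists t s', [/\ exec p s t s', t <= T & Q s'].

Lemma runs_weaken p s T T' (Q Q' : state -> Prop) :
  runs p s T Q -> T <= T' -> (forall s', Q s' -> Q' s') -> runs p s T' Q'.
Proof.
move=> [t [s' [ex tT q]]] le imp; exists t, s'.
by split=> //; [exact: leq_trans le | exact: imp].
Qed.

Lemma runs_le p s T T' (Q : state -> Prop) : runs p s T Q -> T <= T' -> runs p s T' Q.
Proof. by move=> run le; apply: runs_weaken run le _. Qed.

Lemma runs_seq p q s T1 T2 (Q : state -> Prop) :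
  runs p s T1 (fun s' => runs q s' T2 Q) -> runs (Seq p q) s (T1 + T2) Q.
Proof.
move=> [t1 [s1 [ex1 le1 [t2 [s2 [ex2 le2 q2]]]]]].
exists (t1 + t2), s2; split=> //; last exact: leq_add.
exact: ExecSeq ex1 ex2.
Qed.

Lemma runs_if e p q s T (Q : state -> Prop) :
  (eval s e != 0 -> runs p s T Q) -> (eval s e = 0 -> runs q s T Q) ->
  runs (If e p q) s ((cost e).+1 + T) Q.
Proof.
move=> true_case false_case; have [z|nz] := eqVneq (eval s e) 0.
  have [t [s' [ex le q']]] := false_case z.
  by exists ((cost e).+1 + t), s'; split=> //; [exact: ExecIfFalse | rewrite leq_add2l].
have [t [s' [ex le q']]] := true_case nz.
by exists ((cost e).+1 + t), s'; split=> //; [exact: ExecIfTrue | rewrite leq_add2l].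
Qed.

(* The potential pays for every step, so that it also serves as a variant. *)
Lemma runs_while e p (I : state -> Prop) (pot : state -> nat) (Q : state -> Prop) s :
  I s ->
  (forall s, I s -> eval s e != 0 -> exists T,
     runs p s T (fun s' => I s' /\ (cost e).+1 + T + pot s' <= pot s)) ->
  (forall s, I s -> eval s e = 0 -> (cost e).+1 <= pot s /\ Q s) ->
  runs (While e p) s (pot s) Q.
Proof.
move=> + step stop; have [n] := ubnP (pot s).
elim: n s => // n IHn s lt_n Is.
have [z|nz] := eqVneq (eval s e) 0.
  have [le q] := stop s Is z.
  by exists (cost e).+1, s; split=> //; exact: ExecWhileFalse.
have [T [t [s1 [ex1 le1 [Is1 le_pot]]]]] := step s Is nz.
have [|t2 [s2 [ex2 le2 q2]]] := IHn s1 _ Is1; first by lia.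
exists ((cost e).+1 + t + t2), s2; split=> //; first exact: ExecWhileTrue ex1 ex2.
by lia.
Qed.

(** * Loop-free programs, run by computation *)

Fixpoint straight (p : program) : bool :=
  match p with
  | Seq p q | If _ p q => straight p && straight q
  | While _ _ => false
  | _ => true
  end.

(** The value at [While] is a placeholder, here and in [max_cost]: both are used only on programs
    satisfying [straight]. *)
Fixpoint denote (p : program) (s : state) : state :=
  match p with
  | Skip | While _ _ => s
  | Set_ x e => set_reg s x (eval s e)
  | Put a e1 e2 => set_arr s a (eval s e1) (eval s e2)
  | Seq p q => denote q (denote p s)
  | If e p q => if eval s e == 0 then denote q s else denote p s
  end.

Fixpoint max_cost (p : program) : nat :=
  match p with
  | Skip | While _ _ => 1
  | Set_ _ e => (cost e).+1
  | Put _ e1 e2 => (cost e1 + cost e2).+1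
  | Seq p q => max_cost p + max_cost q
  | If e p q => (cost e).+1 + maxn (max_cost p) (max_cost q)
  end.

Lemma runs_straight p s T (Q : state -> Prop) :
  straight p -> max_cost p <= T -> Q (denote p s) -> runs p s T Q.
Proof.
move=> str le q.
suff [t [s' [ex le' eq]]] : runs p s (max_cost p) (eq (denote p s)).
  by exists t, s'; split=> //; [exact: leq_trans le | rewrite -eq].
elim: p s str {T Q le q} => //=.
- by move=> s _; exists 1, s; split=> //; exact: ExecSkip.
- by move=> x e s _; exists (cost e).+1; eexists; split; [exact: ExecSet| |].
- by move=> a e1 e2 s _; eexists; eexists; split; [exact: ExecPut| |].
- move=> p IHp q IHq s /andP[/IHp Hp /IHq Hq]; apply: runs_seq.
  by apply: (runs_weaken (Hp s)) => // s1 <-; exact: Hq.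
move=> e p IHp q IHq s /andP[/IHp Hp /IHq Hq]; apply: runs_if => [/negbTE->|->].
  by apply: (runs_weaken (Hp s)) => //; exact: leq_maxl.
by apply: (runs_weaken (Hq s)) => //; exact: leq_maxr.
Qed.

Lemma runs_straight_seq p q s T T' (Q : state -> Prop) :
  straight p -> max_cost p + T <= T' -> runs q (denote p s) T Q ->
  runs (Seq p q) s T' Q.
Proof.
move=> str le q'; apply: runs_le le.
by apply: runs_seq; apply: runs_straight.
Qed.

(** * Registers and arrays that a program leaves unchanged *)

Fixpoint wregs (p : program) : seq nat :=
  match p with
  | Set_ x _ => [:: x]
  | Seq p q | If _ p q => wregs p ++ wregs q
  | While _ p => wregs p
  | _ => [::]
  end.

Fixpoint warrs (p : program) : seq nat :=
  match p with
  | Put a _ _ => [:: a]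
  | Seq p q | If _ p q => warrs p ++ warrs q
  | While _ p => warrs p
  | _ => [::]
  end.

Definition frame (p : program) (s s' : state) : Prop :=
  (forall x, x \notin wregs p -> reg s' x = reg s x) /\
  (forall a, a \notin warrs p -> arr s' a = arr s a).

(** What can change is read off the syntax, so facts about untouched memory cross a call by deciding
    membership in a concrete list. *)
Lemma exec_frame p s t s' : exec p s t s' -> frame p s s'.
Proof.
rewrite /frame; elim=> {p s t s'} //=.
- by move=> s x e; split=> // y; rewrite inE => /negbTE->.
- by move=> s a e1 e2; split=> // b; rewrite inE => /negbTE->.
- move=> p q s t1 s1 t2 s2 _ [r1 a1] _ [r2 a2].
  by split=> y; rewrite mem_cat negb_or => /andP[yp yq];
    [rewrite r2 // r1 | rewrite a2 // a1].
- move=> e p q s t s' _ _ [r1 a1].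
  by split=> y; rewrite mem_cat negb_or => /andP[yp yq]; [rewrite r1 | rewrite a1].
- move=> e p q s t s' _ _ [r1 a1].
  by split=> y; rewrite mem_cat negb_or => /andP[yp yq]; [rewrite r1 | rewrite a1].
move=> e p s t1 s1 t2 s2 _ _ [r1 a1] _ [r2 a2].
by split=> y yp; [rewrite r2 // r1 | rewrite a2 // a1].
Qed.

Lemma runs_frame p s T (Q : state -> Prop) :
  runs p s T Q -> runs p s T (fun s' => Q s' /\ frame p s s').
Proof.
move=> [t [s' [ex le q]]]; exists t, s'; split=> //.
by split=> //; exact: exec_frame ex.
Qed.

(** * Counting loops *)

Definition Incr (x : nat) : program := Set_ x (Add (Reg x) (Cst 1)).

Definition For (i : nat) (e : expr) (p : program) : program :=
  Seq (Set_ i (Cst 0)) (While (Ltn (Reg i) e) (Seq p (Incr i))).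

(** A round costs [T] for the body, [cost e + 3] for the guard and 4 for the increment; the
    initialisation costs 2 and the last, failing guard again [cost e + 3]. *)
Lemma runs_for i e p s n T (I : nat -> state -> Prop) :
  I 0 (set_reg s i 0) ->
  (forall j s, I j s -> eval s e = n) ->
  (forall j s, j < n -> I j s -> reg s i = j ->
     runs p s T (fun s' => reg s' i = j /\ I j.+1 (set_reg s' i j.+1))) ->
  runs (For i e p) s (n * (T + cost e + 7) + cost e + 5) (I n).
Proof.
move=> I0 eE step.
apply: (runs_straight_seq (T := n * (T + cost e + 7) + cost e + 3)) => //=; first lia.
pose s0 := set_reg s i 0; rewrite -[set_reg s i 0]/s0.
have s0i : reg s0 i = 0 by rewrite /= eqxx.
pose pot (s : state) := (n - reg s i) * (T + cost e + 7) + cost e + 3.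
rewrite -[X in runs _ _ X]/(n * (T + cost e + 7) + cost e + 3).
have -> : n * (T + cost e + 7) + cost e + 3 = pot s0 by rewrite /pot s0i subn0.
apply: (runs_while (I := fun s => I (reg s i) s /\ reg s i <= n)).
- by rewrite s0i.
- move=> s1 [Is1 _] /=; rewrite (eE _ _ Is1) eqb0 negbK => lt.
  exists (T + 4); apply: runs_seq.
  apply: (runs_weaken (step _ _ lt Is1 erefl)) => // s2 [s2i Is2].
  apply: runs_straight => //=; rewrite addn1 eqxx s2i; split=> //.
  by rewrite /pot /= eqxx; nia.
move=> s1 [Is1 le] /=; rewrite (eE _ _ Is1) => /eqP; rewrite eqb0 -leqNgt => ge.
have eqn : reg s1 i = n by apply/eqP; rewrite eqn_leq le.
by rewrite eqn in Is1; split=> //; rewrite /pot; lia.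
Qed.

(** * Bipartite matching with prices *)

Definition upd (f : nat -> nat) (x v : nat) : nat -> nat :=
  fun y => if y == x then v else f y.

Lemma upd_same f x v : upd f x v x = v.
Proof. by rewrite /upd eqxx. Qed.

Lemma upd_other f x v y : y != x -> upd f x v y = f y.
Proof. by rewrite /upd => /negbTE->. Qed.

Section Bipartite.

Variables (m : nat) (deg : nat -> nat) (adj : nat -> nat -> nat).

Definition edge (r b : nat) : Prop := exists2 j, j < deg r & adj r j = b.

(** The invariants on owners and prices are restricted to these numbers, because other cells of the
    arrays may hold stale values. *)
Definition elem (b : nat) : Prop := exists2 r, r < m & edge r b.

Definition perfect : Prop := exists f : nat -> nat,
  (forall r, r < m -> edge r (f r)) /\
  (forall r r', r < m -> r' < m -> f r = f r' -> r = r').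

(* [mt r = b.+1] and [ow b = r.+1] when [r] and [b] are matched; 0 stands for
   an unmatched row or element. *)
Definition matched (mt ow : nat -> nat) : Prop :=
  (forall r b, r < m -> mt r = b.+1 -> ow b = r.+1 /\ edge r b) /\
  (forall b r, elem b -> ow b = r.+1 -> r < m /\ mt r = b.+1).

Definition unmatched (mt : nat -> nat) : nat := #|[set r : 'I_m | mt r == 0]|.

Lemma unmatched_augment (mt mt' : nat -> nat) r :
  r < m -> mt r = 0 -> mt' r != 0 ->
  (forall r', r' != r -> (mt' r' == 0) = (mt r' == 0)) ->
  unmatched mt = (unmatched mt').+1.
Proof.
move=> lt mt0 mt'0 same; rewrite /unmatched (cardsD1 (Ordinal lt)) inE mt0 eqxx.
rewrite add1n; congr (_.+1); apply: eq_card => i; rewrite !inE -val_eqE /=.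
by have [->|ne /=] := eqVneq (i : nat) r; [rewrite (negbTE mt'0) | rewrite same].
Qed.

Lemma unmatched_gt0 (mt : nat -> nat) r : r < m -> mt r = 0 -> 0 < unmatched mt.
Proof. by move=> lt mt0; apply/card_gt0P; exists (Ordinal lt); rewrite inE mt0. Qed.

Lemma matched_perfect mt ow :
  matched mt ow -> (forall r, r < m -> mt r != 0) -> perfect.
Proof.
move=> [mtP _] all_matched.
have {}mtP r : r < m -> ow (mt r).-1 = r.+1 /\ edge r (mt r).-1.
  by move=> lt; apply: mtP => //; rewrite prednK // lt0n all_matched.
exists (fun r => (mt r).-1); split=> [r /mtP[]//|r r' /mtP[eqr _] /mtP[eqr' _] eqf].
by apply: succn_inj; rewrite -eqr eqf eqr'.
Qed.

(* [level j] counts the matched rows whose element costs at least [j].  The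
   rows to which [f] assigns such an element inject into them, through the
   owner of that element, and they comprise the unmatched rows as well as,
   prices being nearly minimal, the rows counted by [level j.+1]. *)
Lemma prices_bound mt ow pr k :
  matched mt ow ->
  (forall b, elem b -> ow b = 0 -> pr b = 0) ->
  (forall r b b', r < m -> mt r = b.+1 -> edge r b' -> pr b <= (pr b').+1) ->
  (forall r b, r < m -> mt r = 0 -> edge r b -> k <= pr b) ->
  perfect -> k.+1 * unmatched mt <= m.
Proof.
move=> [mtP owP] free slack unmatchedP [f [fE f_inj]].
have felem r : r < m -> elem (f r) by move=> lt; exists r => //; exact: fE.
pose U := [set r : 'I_m | mt r == 0].
pose L j := [set r : 'I_m | (mt r != 0) && (j <= pr (mt r).-1)].
pose A j := [set r : 'I_m | j <= pr (f r)].
have UL j : [disjoint U & L j].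
  by rewrite -setI_eq0; apply/eqP/setP=> r; rewrite !inE; case: eqP.
have AL j : 0 < j -> #|A j| <= #|L j|.
  move=> j_gt0; have ownerP (r : 'I_m) : r \in A j ->
      (ow (f r)).-1 < m /\ mt (ow (f r)).-1 = (f r).+1.
    rewrite inE => le; case E: (ow (f r)) => [|r'] /=.
      by rewrite free ?leqn0 in le; [lia | exact: felem |].
    by apply: owP E; exact: felem.
  (* The default [r] is never taken for [r] in [A j], where the element [f r] has a positive price
     and hence an owner below [m]. *)
  pose g (r : 'I_m) : 'I_m := insubd r (ow (f r)).-1.
  have gE r : r \in A j -> g r = (ow (f r)).-1 :> nat.
    by move=> /ownerP[lt _]; rewrite val_insubd lt.
  rewrite -(card_in_imset (f := g)); last first.
    move=> r r' rA r'A eqg; apply/val_inj/f_inj => //=; apply: succn_inj.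
    by rewrite -(ownerP _ rA).2 -(ownerP _ r'A).2 -!gE // eqg.
  apply/subset_leq_card/subsetP=> _ /imsetP[r rA ->].
  by rewrite inE gE // (ownerP _ rA).2 /=; rewrite inE in rA.
have step j : 0 < j <= k -> #|U| + #|L j.+1| <= #|L j|.
  move=> /andP[j_gt0 le_jk]; rewrite -cardsUI (disjoint_setI0 (UL _)) cards0 addn0.
  apply: leq_trans (AL _ j_gt0); apply/subset_leq_card/subsetP=> r; rewrite !inE.
  have [mt0 _|mtr /= le] := eqVneq (mt r) 0.
    by apply: leq_trans le_jk _; apply: unmatchedP mt0 _ => //; exact: fE.
  rewrite -ltnS; apply: leq_trans le _; apply: slack (fE _ (ltn_ord r)) => //.
  by case: (mt r) mtr.
(* Telescoping the inequalities for 1, ..., k; since [U] and [L 1] are disjoint sets of rows, one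
   more copy of [#|U|] still fits into [m]. *)
have iter j : j <= k -> j * #|U| + #|L j.+1| <= #|L 1|.
  by elim: j => // j IHj lt; have := IHj (ltnW lt); have := step j.+1 lt; lia.
have := iter k (leqnn k).
suff : #|U| + #|L 1| <= m by rewrite /unmatched -/U; lia.
by rewrite -cardsUI (disjoint_setI0 (UL _)) cards0 addn0 -[m in _ <= m]card_ord max_card.
Qed.

(** A violation of Hall's condition: under a perfect matching [f], sending a row of [qs] to the
    owner of its [f]-element would inject [qs] into [qs] without [root], which owns nothing. *)
Lemma not_perfect mt ow qs root :
  matched mt ow -> uniq qs -> {in qs, forall r, r < m} ->
  root \in qs -> mt root = 0 ->
  (forall r b, r \in qs -> edge r b -> exists2 r', r' \in qs & ow b = r'.+1) ->
  ~ perfect.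
Proof.
move=> [mtP owP] qs_uniq qs_lt root_qs root0 closed [f [fE f_inj]].
have ownerP r : r \in qs -> [/\ (ow (f r)).-1 \in qs, (ow (f r)).-1 < m
    & mt (ow (f r)).-1 = (f r).+1].
  move=> rqs; have lt := qs_lt r rqs; have [r' r'qs E] := closed _ _ rqs (fE _ lt).
  have elem_fr : elem (f r) by exists r => //; exact: fE.
  by rewrite E /=; have [-> ->] := owP _ _ elem_fr E.
have : size [seq (ow (f r)).-1 | r <- qs] <= size (rem root qs).
  apply: uniq_leq_size => [|_ /mapP[r rqs ->]].
    rewrite map_inj_in_uniq // => r r' rqs r'qs eqow.
    apply: f_inj; [exact: qs_lt | exact: qs_lt|apply: succn_inj].
    by have [_ _ <-] := ownerP r rqs; have [_ _ <-] := ownerP r' r'qs; rewrite eqow.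
  rewrite mem_rem_uniq // inE; have [-> _ mtE] := ownerP r rqs.
  by rewrite andbT; apply: contra_eq_neq root0 => <-; rewrite mtE.
rewrite size_map size_rem //; case: qs root_qs {qs_uniq qs_lt closed ownerP} => //= a q _.
by rewrite ltnn.
Qed.

(* [b] is free, but [ow b] may be out of date. *)
Definition matched_but (b : nat) (mt ow : nat -> nat) : Prop :=
  [/\ forall r b', r < m -> mt r = b'.+1 -> ow b' = r.+1 /\ edge r b',
      forall b' r, elem b' -> b' != b -> ow b' = r.+1 -> r < m /\ mt r = b'.+1
    & forall r, r < m -> mt r <> b.+1].

Lemma free_matched_but b mt ow :
  matched mt ow -> ow b = 0 -> matched_but b mt ow.
Proof.
move=> [mtP owP] free; split=> // [b' r eb _|r lt mtr]; first exact: owP.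
by have [] := mtP r b lt mtr; rewrite free.
Qed.

Lemma evict_matched_but b r mt ow :
  matched mt ow -> elem b -> ow b = r.+1 -> matched_but b (upd mt r 0) ow.
Proof.
move=> [mtP owP] eb owb; have [lt mtr] := owP b r eb owb; split.
- by move=> r' b' lt'; have [->|ne] := eqVneq r' r;
    rewrite ?upd_same ?upd_other //; exact: mtP.
- move=> b' r' eb' ne owb'; have [lt' mtr'] := owP b' r' eb' owb'.
  rewrite upd_other //; apply: contra_neq ne => eqr.
  by move: mtr'; rewrite eqr mtr => -[].
move=> r' lt'; have [->|ne] := eqVneq r' r; rewrite ?upd_same ?upd_other //.
by move=> /(mtP r' b lt') []; rewrite owb => -[eqr]; rewrite eqr eqxx in ne.
Qed.

Lemma assign_matched b r mt ow :
  matched_but b mt ow -> r < m -> edge r b -> mt r = 0 ->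
  matched (upd mt r b.+1) (upd ow b r.+1).
Proof.
move=> [mtP owP free] lt e mtr; split=> [r' b' lt'|b' r' eb'].
  have [-> |ne] := eqVneq r' r; first by rewrite upd_same => -[<-]; rewrite upd_same.
  rewrite upd_other // => mtr'; have [owb' e'] := mtP _ _ lt' mtr'.
  rewrite upd_other //; apply: contra_not_neq (free _ lt') => eqb.
  by rewrite -eqb.
have [->|ne] := eqVneq b' b; first by rewrite upd_same => -[<-]; rewrite upd_same.
rewrite upd_other // => /(owP _ _ eb' ne)[lt' mtr']; split=> //.
by rewrite upd_other //; apply: contra_eq_neq mtr' => ->; rewrite mtr.
Qed.

(** One flip along an augmenting path: [r] moves to the free element [b], and the element [b0] that
    it leaves becomes the free one, with [ow b0] still naming [r]. *)
Lemma assign_matched_but b b0 r mt ow :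
  matched_but b mt ow -> r < m -> edge r b -> mt r = b0.+1 ->
  matched_but b0 (upd mt r b.+1) (upd ow b r.+1).
Proof.
move=> [mtP owP free] lt e mtr.
have neb : b0 != b by apply/eqP=> eqb; apply: (free r lt); rewrite mtr eqb.
split=> [r' b' lt'|b' r' eb' ne0|r' lt'].
- have [-> |ne] := eqVneq r' r; first by rewrite upd_same => -[<-]; rewrite upd_same.
  rewrite upd_other // => mtr'; have [owb' e'] := mtP _ _ lt' mtr'.
  rewrite upd_other //; apply: contra_not_neq (free _ lt') => eqb.
  by rewrite -eqb.
- have [->|ne] := eqVneq b' b; first by rewrite upd_same => -[<-]; rewrite upd_same.
  rewrite upd_other // => /(owP _ _ eb' ne)[lt' mtr']; split=> //.
  by rewrite upd_other //; apply: contra_neq ne0 => eqr; move: mtr'; rewrite eqr mtr => -[].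
have [->|ne] := eqVneq r' r.
  by rewrite upd_same => -[eqb]; rewrite eqb eqxx in neb.
rewrite upd_other // => /(mtP _ _ lt')[].
by have [-> _ [eqr]] := mtP _ _ lt mtr; rewrite eqr eqxx in ne.
Qed.

(** * Prices and the invariant of the auction *)

Variable k : nat.

(** Approximate complementary slackness: a matched row holds an element that is cheapest in its list
    up to the bid increment 1. *)
Record priced (mt ow pr : nat -> nat) : Prop := Priced {
  priced_free : forall b, elem b -> ow b = 0 -> pr b = 0;
  priced_slack : forall r b b',
    r < m -> mt r = b.+1 -> edge r b' -> pr b <= (pr b').+1;
  priced_cap : forall r b, r < m -> mt r = b.+1 -> pr b <= k }.

Lemma priced_unassign mt ow pr r : priced mt ow pr -> priced (upd mt r 0) ow pr.
Proof.
move=> [free slack cap]; split=> // [r' b b'|r' b]; rewrite /upd; case: eqP => // _.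
  exact: slack.
exact: cap.
Qed.

Lemma priced_assign mt ow pr r b : priced mt ow pr -> matched_but b mt ow ->
  pr b < k -> (forall b', edge r b' -> pr b <= pr b') ->
  priced (upd mt r b.+1) (upd ow b r.+1) (upd pr b (pr b).+1).
Proof.
move=> [free slack cap] [mtP owP unb] lt_k minb.
have pr_le b' : pr b' <= upd pr b (pr b).+1 b'.
  by rewrite /upd; case: eqP => // ->.
split=> [b' eb'|r' b' b'' lt'|r' b' lt'].
- by rewrite /upd; case: eqP => // _; exact: free.
- have [->|ne] := eqVneq r' r.
    rewrite upd_same => -[<-]; rewrite upd_same ltnS => /minb le.
    exact: leq_trans le (pr_le _).
  rewrite upd_other // => mtr' e; rewrite upd_other.
    apply: leq_trans (slack _ _ _ lt' mtr' e) _; rewrite ltnS; exact: pr_le.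
  by apply: contra_not_neq (unb _ lt') => <-.
have [->|ne] := eqVneq r' r; first by rewrite upd_same => -[<-]; rewrite upd_same.
rewrite upd_other // => mtr'; rewrite upd_other; first exact: cap mtr'.
by apply: contra_not_neq (unb _ lt') => <-.
Qed.

(** A potential bounding the number of bids. An eviction gives back the old price of the element and
    the new assignment adds that price plus one. The factor [mt r != 0] masks the meaningless
    predecessor of 0. *)
Definition worth (mt pr : nat -> nat) : nat :=
  \sum_(r < m) (mt r != 0) * pr (mt r).-1.

Lemma worth_le mt ow pr : priced mt ow pr -> worth mt pr <= k * m.
Proof.
move=> [_ _ cap]; rewrite /worth mulnC -[X in _ <= X * _]card_ord -sum_nat_const.
apply: leq_sum => r _; case E: (mt r) => [|b] //=.
by rewrite mul1n; exact: cap E.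
Qed.

Lemma worth_assign mt ow pr r b : matched_but b mt ow -> r < m -> mt r = 0 ->
  worth (upd mt r b.+1) (upd pr b (pr b).+1) = worth mt pr + (pr b).+1.
Proof.
move=> [mtP owP unb] lt mtr; rewrite /worth (bigD1 (Ordinal lt)) //=.
rewrite [in RHS](bigD1 (Ordinal lt)) //= mtr upd_same /= upd_same mul1n addnC.
congr (_ + _); apply: eq_bigr => i; rewrite -val_eqE /= => ne; rewrite upd_other //.
case E: (mt i) => [|b'] //=; rewrite upd_other //.
by apply: contra_not_neq (unb _ (ltn_ord i)) => <-.
Qed.

Lemma worth_unassign mt pr r b : r < m -> mt r = b.+1 ->
  worth (upd mt r 0) pr + pr b = worth mt pr.
Proof.
move=> lt mtr; rewrite /worth (bigD1 (Ordinal lt)) //=.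
rewrite [in RHS](bigD1 (Ordinal lt)) //= mtr upd_same /= mul1n addnC.
by congr (_ + _); apply: eq_bigr => i; rewrite -val_eqE /= => ne; rewrite upd_other.
Qed.

(* Rows are treated in order: [r] is the row that has to bid while row [i] is
   being treated, which is [i] itself or a row that it has evicted, possibly
   indirectly. *)
Record auction (i r : nat) (mt ow pr : nat -> nat) : Prop := Auctioning {
  auction_matched : matched mt ow;
  auction_priced : priced mt ow pr;
  auction_le : r <= i <= m;
  auction_row : if i < m then mt r == 0 else r == m;
  auction_todo : forall r', i < r' < m -> mt r' = 0;
  auction_done : forall r' b, r' < m -> mt r' = 0 -> r' <= i -> r' != r ->
    edge r' b -> k <= pr b }.

Lemma auction_next i mt ow pr : i < m ->
  matched mt ow -> priced mt ow pr ->
  (forall r', i < r' < m -> mt r' = 0) ->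
  (forall r' b, r' < m -> mt r' = 0 -> r' <= i -> edge r' b -> k <= pr b) ->
  auction i.+1 i.+1 mt ow pr.
Proof.
move=> lt_i mP pP todo dn; split=> //.
- by rewrite leqnn.
- by case: ltnP => [lt|ge]; [rewrite todo ?leqnn | rewrite eqn_leq ge lt_i].
- by move=> r' /andP[lt lt']; apply: todo; rewrite lt' (ltnW lt).
by move=> r' b lt mtr le ne; apply: dn => //; rewrite -ltnS ltn_neqAle ne le.
Qed.

Lemma auction_bid_free i r b mt ow pr : auction i r mt ow pr -> i < m ->
  edge r b -> pr b < k -> (forall b', edge r b' -> pr b <= pr b') -> ow b = 0 ->
  let mt' := upd mt r b.+1 in let pr' := upd pr b (pr b).+1 in
  auction i.+1 i.+1 mt' (upd ow b r.+1) pr' /\ worth mt pr < worth mt' pr'.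
Proof.
move=> [mP pP /andP[le_ri _] + todo dn] lt_i e lt_k minb owb /=.
rewrite lt_i => /eqP mtr; have lt_r := leq_ltn_trans le_ri lt_i.
have mb := free_matched_but mP owb; split; last first.
  by rewrite (worth_assign _ mb) // addnS ltnS leq_addr.
apply: auction_next => //; [exact: assign_matched|exact: priced_assign| |].
  move=> r' /andP[lt lt']; rewrite upd_other ?todo ?lt //.
  by rewrite gtn_eqF // (leq_ltn_trans le_ri).
move=> r' b' lt'; have [->|ne] := eqVneq r' r; first by rewrite upd_same.
rewrite upd_other // => mtr' le e'; apply: leq_trans (dn r' b' _ _ _ ne e') _ => //.
by rewrite /upd; case: eqP => // ->.
Qed.

Lemma auction_bid_evict i r r1 b mt ow pr : auction i r mt ow pr -> i < m ->
  edge r b -> pr b < k -> (forall b', edge r b' -> pr b <= pr b') ->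
  ow b = r1.+1 ->
  let mt' := upd (upd mt r1 0) r b.+1 in let pr' := upd pr b (pr b).+1 in
  auction i r1 mt' (upd ow b r.+1) pr' /\ worth mt pr < worth mt' pr'.
Proof.
move=> [mP pP /andP[le_ri le_im] + todo dn] lt_i e lt_k minb owb /=.
rewrite lt_i => /eqP mtr; have lt_r := leq_ltn_trans le_ri lt_i.
have eb : elem b by exists r.
have [lt_r1 mtr1] := mP.2 b r1 eb owb.
have ne1 : r1 != r by apply: contra_eq_neq mtr1 => ->; rewrite mtr.
have mb := evict_matched_but mP eb owb; split; last first.
  rewrite (worth_assign _ mb) //; last by rewrite upd_other // eq_sym.
  by rewrite -(worth_unassign pr lt_r1 mtr1) addnS ltnS.
split.
- by apply: assign_matched => //; rewrite upd_other // eq_sym.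
- by apply: priced_assign => //; exact: priced_unassign.
(* The evicted row is at most [i], as the rows after [i] have not been matched yet. *)
- by rewrite le_im andbT leqNgt; apply/negP=> lt; rewrite todo ?lt in mtr1.
- by rewrite lt_i upd_other // upd_same.
- move=> r' /andP[lt lt']; rewrite upd_other; last first.
    by rewrite gtn_eqF // (leq_ltn_trans le_ri).
  by rewrite /upd; case: eqP => // _; rewrite todo ?lt.
move=> r' b' lt'; have [->|ne] := eqVneq r' r; first by rewrite upd_same.
rewrite upd_other // => mtr' le ne1' e'; rewrite upd_other // in mtr'.
apply: leq_trans (dn r' b' _ _ _ ne e') _ => //.
by rewrite /upd; case: eqP => // ->.
Qed.

Lemma auction_give_up i r mt ow pr : auction i r mt ow pr -> i < m ->
  (forall b, edge r b -> k <= pr b) -> auction i.+1 i.+1 mt ow pr.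
Proof.
move=> [mP pP _ _ todo dn] lt_i min_r; apply: auction_next => // r' b lt mtr le.
by have [->|ne] := eqVneq r' r; [exact: min_r | exact: dn].
Qed.

Lemma auction_unmatched mt ow pr : auction m m mt ow pr ->
  perfect -> k.+1 * unmatched mt <= m.
Proof.
move=> [mP [free slack _] _ _ _ dn]; apply: prices_bound mP free slack _.
move=> r b lt mtr; apply: dn => //; first exact: ltnW.
by rewrite ltn_eqF.
Qed.

End Bipartite.

(** * The programs *)

Local Notation Sub := Defs.Sub (only parsing).
Local Notation "p ;; q" := (Seq p q)
  (at level 90, right associativity, only parsing).
Local Notation "x ::= e" := (Set_ x e) (at level 70, only parsing).
Local Notation "a @[ i ] ::= e" := (Put a i e)
  (at level 70, i at level 69, only parsing).

Local Notation r_m := 0 (only parsing).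
Local Notation r_l := 2 (only parsing).
Local Notation r_x := 3 (only parsing).
Local Notation r_k := 4 (only parsing).
Local Notation r_ans := 5 (only parsing).
Local Notation r_i := 6 (only parsing).
Local Notation r_row := 7 (only parsing).
Local Notation r_j := 8 (only parsing).
Local Notation r_b := 9 (only parsing).
Local Notation r_price := 10 (only parsing).
Local Notation r_own := 11 (only parsing).
Local Notation r_d := 12 (only parsing).
Local Notation r_off := 13 (only parsing).
Local Notation r_head := 14 (only parsing).
Local Notation r_tail := 15 (only parsing).
Local Notation r_found := 16 (only parsing).

(* The rows and elements stored in [a_ow] and [a_mt] are shifted by one, as in
   [matched]; [a_off] holds the address of each row in [a_in]. *)
Local Notation a_in := 0 (only parsing).
Local Notation a_out := 1 (only parsing).
Local Notation a_off := 2 (only parsing).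
Local Notation a_deg := 3 (only parsing).
Local Notation a_mt := 4 (only parsing).
Local Notation a_ow := 5 (only parsing).
Local Notation a_pr := 6 (only parsing).
Local Notation a_queue := 7 (only parsing).
Local Notation a_parent := 8 (only parsing).
Local Notation a_seen := 9 (only parsing).
Local Notation a_taken := 10 (only parsing).

Definition Entry (row : expr) : expr := Get a_in (Add (Get a_off row) (Reg r_j)).

(** The minimum starts at [r_k], so that a final price below [r_k] means that [r_b] is a cheapest
    element; otherwise [r_b] is stale and every element costs at least [r_k]. *)
Definition Scan : program :=
  r_price ::= Reg r_k ;;
  For r_j (Get a_deg (Reg r_row))
    (r_d ::= Entry (Reg r_row) ;;
     If (Ltn (Get a_pr (Reg r_d)) (Reg r_price))
        (r_price ::= Get a_pr (Reg r_d) ;; r_b ::= Reg r_d)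
        Skip).

Definition Next_row : program := Incr r_i ;; r_row ::= Reg r_i.

Definition Assign : program :=
  a_ow @[ Reg r_b ] ::= Add (Reg r_row) (Cst 1) ;;
  a_mt @[ Reg r_row ] ::= Add (Reg r_b) (Cst 1).

Definition Bid : program :=
  Scan ;;
  If (Ltn (Reg r_price) (Reg r_k))
     (r_own ::= Get a_ow (Reg r_b) ;;
      If (Reg r_own) (a_mt @[ Sub (Reg r_own) (Cst 1) ] ::= Cst 0) Skip ;;
      Assign ;;
      a_pr @[ Reg r_b ] ::= Add (Reg r_price) (Cst 1) ;;
      If (Reg r_own) (r_row ::= Sub (Reg r_own) (Cst 1)) Next_row)
     Next_row.

Definition Auction : program :=
  r_i ::= Cst 0 ;; r_row ::= Cst 0 ;; While (Ltn (Reg r_i) (Reg r_m)) Bid.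

Definition Visit : program :=
  r_b ::= Entry (Reg r_row) ;;
  r_own ::= Get a_ow (Reg r_b) ;;
  Incr r_j ;;
  If (Reg r_own)
     (r_own ::= Sub (Reg r_own) (Cst 1) ;;
      If (Get a_seen (Reg r_own)) Skip
         (a_seen @[ Reg r_own ] ::= Cst 1 ;;
          a_parent @[ Reg r_own ] ::= Reg r_row ;;
          a_queue @[ Reg r_tail ] ::= Reg r_own ;;
          Incr r_tail))
     (r_found ::= Cst 1).

(** In the guard, truncated subtraction of the flag [r_found] expresses the conjunction with its
    negation. The loop stops as soon as a free element is found, leaving the end of the path in
    [r_row] and [r_b]. *)
Definition Explore : program :=
  (r_row ::= Get a_queue (Reg r_head) ;; Incr r_head ;; r_j ::= Cst 0) ;;
  While (Sub (Ltn (Reg r_j) (Get a_deg (Reg r_row))) (Reg r_found)) Visit.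

Definition Search : program :=
  For r_j (Reg r_m) (a_seen @[ Reg r_j ] ::= Cst 0) ;;
  (a_queue @[ Cst 0 ] ::= Reg r_i ;;
   a_seen @[ Reg r_i ] ::= Cst 1 ;;
   r_head ::= Cst 0 ;; r_tail ::= Cst 1 ;; r_found ::= Cst 0) ;;
  While (Sub (Ltn (Reg r_head) (Reg r_tail)) (Reg r_found)) Explore.

(** [r_own] saves the former entry of the row before [Assign] overwrites it; a saved 0 means that
    the root of the search has been reached. *)
Definition Flip : program :=
  r_own ::= Get a_mt (Reg r_row) ;;
  Assign ;;
  If (Reg r_own)
     (r_b ::= Sub (Reg r_own) (Cst 1) ;; r_row ::= Get a_parent (Reg r_row))
     (r_found ::= Cst 0).

Definition Augment : program := While (Reg r_found) Flip.

(* Each search consumes [k + 1] units of a budget [r_d], initially [m], which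
   runs out only if there is no perfect matching, by [auction_unmatched]. *)
Definition Complete : program :=
  (r_ans ::= Cst 1 ;; r_d ::= Reg r_m ;; r_i ::= Cst 0) ;;
  While (Ltn (Reg r_i) (Reg r_m))
    (If (Get a_mt (Reg r_i)) Skip
        (If (Ltn (Reg r_k) (Reg r_d))
            (r_d ::= Sub (Reg r_d) (Add (Reg r_k) (Cst 1)) ;;
             Search ;;
             If (Reg r_found) Augment (r_ans ::= Cst 0))
            (r_ans ::= Cst 0)) ;;
     Incr r_i).

(** [r_d] holds the square of [r_k], updated by adding [2 k + 1] because the machine has no
    multiplication. *)
Definition Sqrt : program :=
  (r_k ::= Cst 0 ;; r_d ::= Cst 0) ;;
  While (Ltn (Reg r_d) (Reg r_m))
    (r_d ::= Add (Reg r_d) (Add (Add (Reg r_k) (Reg r_k)) (Cst 1)) ;; Incr r_k).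

(** [r_d] counts the entries of the row before [r_x]: it follows [r_j] until [r_x] is met and then
    stays behind. Only the first [m] columns are read, and owners and prices are cleared along the
    way, which keeps the cost independent of the number of elements. *)
Definition Setup : program :=
  r_off ::= Cst 0 ;;
  For r_i (Reg r_m)
    ((a_off @[ Reg r_i ] ::= Reg r_off ;;
      a_mt @[ Reg r_i ] ::= Cst 0 ;;
      r_d ::= Cst 0) ;;
     For r_j (Reg r_m)
       (r_b ::= Get a_in (Add (Reg r_off) (Reg r_j)) ;;
        a_ow @[ Reg r_b ] ::= Cst 0 ;;
        a_pr @[ Reg r_b ] ::= Cst 0 ;;
        If (Eqn (Reg r_j) (Reg r_d))
           (If (Eqn (Reg r_b) (Reg r_x)) Skip (Incr r_d)) Skip) ;;
     a_deg @[ Reg r_i ] ::= Reg r_d ;;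
     r_off ::= Add (Reg r_off) (Reg r_l)).

Definition Avoid : program := Sqrt ;; Setup ;; Auction ;; Complete.

Definition Decide : program := Avoid ;; 0 ::= Reg r_ans.

Local Notation r_y := 20 (only parsing).
Local Notation r_z := 21 (only parsing).
Local Notation r_w := 22 (only parsing).
Local Notation r_c := 23 (only parsing).

(** [Avoid] writes neither the registers 20 to 23 nor [r_x], [a_in], [a_out] and [a_taken], so the
    state of the enumeration survives each test. *)
Definition Listing : program :=
  (r_z ::= Cst 0 ;; r_c ::= Cst 0) ;;
  For r_y (Reg r_m)
    (r_w ::= Cst 0 ;;
     While (Get a_taken (Get a_in (Add (Reg r_z) (Reg r_w)))) (Incr r_w) ;;
     (r_x ::= Get a_in (Add (Reg r_z) (Reg r_w)) ;;
      a_taken @[ Reg r_x ] ::= Cst 1) ;;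
     Avoid ;;
     If (Reg r_ans) Skip (a_out @[ Reg r_c ] ::= Reg r_x ;; Incr r_c) ;;
     r_z ::= Add (Reg r_z) (Reg r_l)) ;;
  0 ::= Reg r_c.

(** * Correctness and cost of the auction and of the augmentations *)

Section Correctness.

Variables (m k : nat) (deg : nat -> nat) (adj : nat -> nat -> nat).
Hypothesis deg_le : forall r, r < m -> deg r <= m.

Local Notation edge := (edge deg adj).
Local Notation elem := (elem m deg adj).
Local Notation perfect := (perfect m deg adj).
Local Notation matched := (matched m deg adj).
Local Notation unmatched := (unmatched m).

Definition graph (s : state) : Prop :=
  [/\ reg s r_m = m, reg s r_k = k,
      forall r, r < m -> arr s a_deg r = deg r
    & forall r j, r < m -> j < deg r -> arr s a_in (arr s a_off r + j) = adj r j].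

Lemma graph_frame p s s' : frame p s s' ->
  ~~ has (mem [:: r_m; r_k]) (wregs p) ->
  ~~ has (mem [:: a_deg; a_off; a_in]) (warrs p) -> graph s -> graph s'.
Proof.
move=> [eqr eqa] /hasPn nr /hasPn na.
have {}eqr x : x \in [:: r_m; r_k] -> reg s' x = reg s x.
  by move=> xin; apply: eqr; apply/negP => /nr; rewrite /= xin.
have {}eqa x : x \in [:: a_deg; a_off; a_in] -> arr s' x = arr s x.
  by move=> xin; apply: eqa; apply/negP => /na; rewrite /= xin.
by rewrite /graph !eqr // !eqa.
Qed.

Lemma runs_scan s r : graph s -> reg s r_row = r -> r < m ->
  runs Scan s (40 * m + 20) (fun s' =>
    [/\ arr s' = arr s, reg s' r_price <= k,
        forall b, edge r b -> reg s' r_price <= arr s a_pr b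
      & reg s' r_price < k -> edge r (reg s' r_b) /\
          arr s a_pr (reg s' r_b) = reg s' r_price]).
Proof.
move=> gs sr lt_r; have [sm sk sdeg sadj] := gs.
apply: (runs_straight_seq (T := 40 * m + 16)) => //=; first lia.
apply: (@runs_le _ _ (deg r * (28 + 2 + 7) + 2 + 5)); last by have := deg_le lt_r; lia.
apply: (runs_weaken (Q := fun s' => [/\ arr s' = arr s /\ reg s' r_row = r,
    reg s' r_price <= k,
    forall j, j < deg r -> reg s' r_price <= arr s a_pr (adj r j)
  & reg s' r_price < k -> edge r (reg s' r_b) /\
          arr s a_pr (reg s' r_b) = reg s' r_price]) _ (leqnn _)); last first.
  by move=> s' [[? _] ? le ?]; split=> // b [j lt <-]; exact: le.
apply: (runs_for (I := fun j s' => [/\ arr s' = arr s /\ reg s' r_row = r,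
    reg s' r_price <= k,
    forall j', j' < j -> reg s' r_price <= arr s a_pr (adj r j')
  & reg s' r_price < k -> edge r (reg s' r_b) /\
          arr s a_pr (reg s' r_b) = reg s' r_price])).
- by split=> //=; rewrite sk ?ltnn.
- by move=> j s' [[as' rs'] _ _ _] /=; rewrite as' rs' sdeg.
move=> j s' lt_j [[as' rs'] le_k le_pr attained] js'.
apply: runs_straight => //=; rewrite as' rs' js' sadj //.
rewrite eqb0 -leqNgt.
case: (leqP (reg s' r_price) (arr s a_pr (adj r j))) => [le|lt] /=.
  split=> //; split=> // j'; rewrite ltnS leq_eqVlt => /orP[/eqP-> //|].
  exact: le_pr.
split=> //; split=> //=.
- exact: ltnW (leq_trans lt le_k).
- move=> j'; rewrite ltnS leq_eqVlt => /orP[/eqP-> //|/le_pr].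
  exact: leq_trans (ltnW lt).
by move=> _; split=> //; exists j.
Qed.

Local Notation auction := (auction m deg adj k).
Local Notation worth := (worth m).

(** A bid either raises [worth] or settles a row and advances [r_i]. The sum of the two never
    exceeds [k * m + m], which bounds the number of bids. *)
Lemma runs_bid s : graph s -> reg s r_i < m ->
  auction (reg s r_i) (reg s r_row) (arr s a_mt) (arr s a_ow) (arr s a_pr) ->
  runs Bid s (40 * m + 100) (fun s' =>
    [/\ graph s',
      auction (reg s' r_i) (reg s' r_row) (arr s' a_mt) (arr s' a_ow) (arr s' a_pr)
    & worth (arr s a_mt) (arr s a_pr) + reg s r_i <
      worth (arr s' a_mt) (arr s' a_pr) + reg s' r_i]).
Proof.
move=> gs; set i := reg s r_i; set r := reg s r_row => lt_i auc.
have lt_r : r < m by case/andP: (auction_le auc) => le _; exact: leq_ltn_trans lt_i.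
apply: (@runs_le _ _ (40 * m + 20 + 80)); last by lia.
apply: runs_seq; apply: (runs_weaken (runs_frame (runs_scan gs erefl lt_r))) => //.
move=> s1 [[as1 le_k minp attained] fr].
have gs1 : graph s1 by exact: graph_frame fr _ _ gs.
have [si sr sk] : [/\ reg s1 r_i = i, reg s1 r_row = r & reg s1 r_k = k].
  by split; [exact: fr.1|exact: fr.1|case: gs1].
apply: runs_straight => //=; rewrite sk eqb0 -leqNgt.
case: (leqP k (reg s1 r_price)) => [ge|lt_p] /=.
  split=> //=; rewrite si as1 addn1; last by rewrite addnS.
  by apply: auction_give_up auc lt_i _ => b /minp; exact: leq_trans.
have [e prb] := attained lt_p; rewrite -prb in minp lt_p *; rewrite as1.
case owb: (arr s a_ow (reg s1 r_b)) => [|r1] /=; rewrite ?as1 ?sr ?si ?addn1 ?subn1 -?prb /=.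
  have [auc' lt_w] := auction_bid_free auc lt_i e lt_p minp owb.
  by split=> //=; rewrite addnS ltnS leq_add2r ltnW.
have [auc' lt_w] := auction_bid_evict auc lt_i e lt_p minp owb.
by split=> //=; rewrite ltn_add2r.
Qed.

Lemma runs_auction s : graph s ->
  (forall r, r < m -> arr s a_mt r = 0) ->
  (forall b, elem b -> arr s a_ow b = 0 /\ arr s a_pr b = 0) ->
  runs Auction s ((k * m + m) * (40 * m + 110) + 20) (fun s' =>
    [/\ graph s', matched (arr s' a_mt) (arr s' a_ow)
      & perfect -> k.+1 * unmatched (arr s' a_mt) <= m]).
Proof.
move=> gs mt0 ow0.
apply: (@runs_straight_seq _ _ _ ((k * m + m) * (40 * m + 110) + 10)) => //=; first lia.
apply: (@runs_straight_seq _ _ _ ((k * m + m) * (40 * m + 110) + 5)) => //=; first lia.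
set s0 := set_reg _ _ _.
pose pot s := (k * m + m - (worth (arr s a_mt) (arr s a_pr) + reg s r_i)) * (40 * m + 110) + 5.
apply: (@runs_le _ _ (pot s0)); last by rewrite leq_add2r leq_mul2r leq_subr orbT.
apply: (runs_while (I := fun s => graph s /\
  auction (reg s r_i) (reg s r_row) (arr s a_mt) (arr s a_ow) (arr s a_pr))).
- split=> //=; split=> //.
  + split=> [r b lt|b r eb /=]; first by rewrite /= mt0.
    by rewrite (ow0 b eb).1.
  + split=> [b eb _|r b b' lt|r b lt] /=; rewrite ?mt0 //; exact: (ow0 b eb).2.
  + by case: posnP => [->|lt]; rewrite ?mt0.
  + by move=> r /andP[_ lt]; exact: mt0.
  by move=> r b lt _; rewrite leqn0 => /eqP-> /eqP.
- move=> s1 [gs1 auc] /=; have [-> _ _ _] := gs1; rewrite eqb0 negbK => lt.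
  exists (40 * m + 100); apply: (runs_weaken (runs_bid gs1 lt auc)) => // s2 [gs2 auc2 gain].
  split=> //; have := worth_le (auction_priced auc2).
  by case/andP: (auction_le auc2) => _; rewrite /pot; nia.
move=> s1 [gs1 auc] /=; have [-> _ _ _] := gs1 => /eqP; rewrite eqb0 => ge.
split; first by apply: leq_trans (leq_addl _ _).
have := auc; have -> : reg s1 r_i = m.
  by apply/eqP; rewrite eqn_leq [m <= _]leqNgt ge andbT; case/andP: (auction_le auc) => _.
(* At the end the bidding row is the dummy [m], so no actual row is exempt from [auction_done]. *)
move=> auc'; have := auction_row auc'; rewrite ltnn => /eqP eqm.
rewrite eqm in auc'; split=> //; first exact: auction_matched auc'.
exact: auction_unmatched auc'.
Qed.

(* [qs] lists the rows reached from [root] by breadth-first search; each of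
   them but [root] owns an element of its parent, which precedes it. *)
Record tree (root : nat) (mt pa : nat -> nat) (qs : seq nat) : Prop := Tree {
  tree_uniq : uniq qs;
  tree_lt : forall r, r \in qs -> r < m;
  tree_mem_root : root \in qs;
  tree_root : forall r, r \in qs -> mt r = 0 -> r = root;
  tree_parent : forall r b, r \in qs -> mt r = b.+1 ->
    edge (pa r) b /\ index (pa r) qs < index r qs }.

Lemma tree_size root mt pa qs : tree root mt pa qs -> size qs <= m.
Proof.
move=> tr; rewrite -(size_iota 0 m); apply: uniq_leq_size (tree_uniq tr) _.
by move=> r /(tree_lt tr); rewrite mem_iota.
Qed.

(** Appending at the end keeps the indices of the rows already queued, so parents still precede
    their children. *)
Lemma tree_push root mt pa qs r o b :
  tree root mt pa qs -> r \in qs -> edge r b ->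
  o < m -> o \notin qs -> mt o = b.+1 ->
  tree root mt (upd pa o r) (rcons qs o).
Proof.
move=> [qu ql qroot qz qp] rq e lt oq mto; split.
- by rewrite rcons_uniq oq.
- by move=> r'; rewrite mem_rcons inE => /predU1P[->//|]; exact: ql.
- by rewrite mem_rcons inE qroot orbT.
- by move=> r'; rewrite mem_rcons inE => /predU1P[->|/qz//]; rewrite mto.
move=> r' b'; rewrite -cats1 mem_cat inE orbC => /predU1P[->|r'q].
  by rewrite mto upd_same => -[<-]; rewrite !index_cat rq (negbTE oq) /= eqxx addn0 index_mem.
move=> /(qp _ _ r'q)[e' lt']; rewrite upd_other; last by apply: contraNneq oq => <-.
split=> //; rewrite !index_cat r'q.
by rewrite -index_mem (ltn_trans lt') // index_mem.
Qed.

Lemma runs_augment s root qs :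
  tree root (arr s a_mt) (arr s a_parent) qs ->
  matched (arr s a_mt) (arr s a_ow) -> arr s a_mt root = 0 ->
  reg s r_row \in qs -> edge (reg s r_row) (reg s r_b) ->
  arr s a_ow (reg s r_b) = 0 -> reg s r_found != 0 ->
  runs Augment s (40 * m + 2) (fun s' =>
    [/\ matched (arr s' a_mt) (arr s' a_ow), arr s' a_mt root != 0
      & forall r, r != root -> (arr s' a_mt r == 0) = (arr s a_mt r == 0)]).
Proof.
move=> tr mP root0 rq e free found; set mt := arr s a_mt.
pose pot s' := if reg s' r_found == 0 then 2 else (index (reg s' r_row) qs).+1 * 40 + 2.
apply: (@runs_le _ _ (pot s)); last first.
  rewrite /pot; case: ifP => _; first exact: leq_addl.
  by rewrite leq_add2r mulnC leq_mul2l (leq_trans _ (tree_size tr)) // index_mem.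
(* While the flag is up, [r_b] is the free element. Rows of [qs] up to the current one keep their
   original entry in [a_mt], and the parent precedes the current row, so the initial tree still
   describes the rest of the path. The index of the current row is the variant. *)
apply: (runs_while (I := fun s' => arr s' a_parent = arr s a_parent /\
  if reg s' r_found == 0 then
    [/\ matched (arr s' a_mt) (arr s' a_ow), arr s' a_mt root != 0
      & forall r, r != root -> (arr s' a_mt r == 0) = (mt r == 0)]
  else
    [/\ reg s' r_row \in qs, edge (reg s' r_row) (reg s' r_b),
        matched_but m deg adj (reg s' r_b) (arr s' a_mt) (arr s' a_ow),
        forall r, r \in qs -> index r qs <= index (reg s' r_row) qs ->
          arr s' a_mt r = mt r
      & forall r, (arr s' a_mt r == 0) = (mt r == 0)])).
- by split=> //; rewrite (negbTE found); split=> //; exact: free_matched_but.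
- move=> s1 [pa1]; rewrite /pot /= => + nf; rewrite (negbTE nf) => -[rq1 e1 mb agree same].
  have mt1 := agree _ rq1 (leqnn _); have lt1 := tree_lt tr rq1.
  exists 36; apply: runs_straight => //=; rewrite mt1 !addn1.
  case mtr: (mt (reg s1 r_row)) => [|b0] /=.
    split=> //; split=> //; have eqr := tree_root tr rq1 mtr.
    rewrite mtr in mt1; split=> /=; first exact: assign_matched mb lt1 e1 mt1.
      by rewrite eqr eqxx.
    by move=> r ne; rewrite eqr (negbTE ne) same.
  rewrite (negbTE nf) subn1 /= pa1; have [e2 lt2] := tree_parent tr rq1 mtr.
  split; last by lia.
  split=> //; split=> //.
  + by rewrite -index_mem (ltn_trans lt2) // index_mem.
  + by rewrite mtr in mt1; exact: assign_matched_but mb lt1 e1 mt1.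
  + move=> r rq' le; rewrite /= ifN; first by apply: agree => //; lia.
    by apply: contraTneq lt2 => eqr; rewrite -leqNgt -{1}eqr.
  by move=> r /=; have [->|_] := eqVneq r (reg s1 r_row); rewrite ?mtr ?same.
by move=> s1 [_]; rewrite /pot /= => + f0; rewrite f0 /= => H; split.
Qed.

(** * Breadth-first search for a free element *)

Section Search.

Variables (root : nat) (mt ow : nat -> nat).
Hypothesis mP : matched mt ow.

Record searching (qs : seq nat) (s : state) : Prop := Searching {
  searching_graph : graph s;
  searching_mt : arr s a_mt = mt;
  searching_ow : arr s a_ow = ow;
  searching_tail : reg s r_tail = size qs;
  searching_queue : forall h, h < size qs -> arr s a_queue h = nth 0 qs h;
  searching_seen : forall r, r < m -> (arr s a_seen r != 0) = (r \in qs);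
  searching_tree : tree root mt (arr s a_parent) qs }.

Definition reached (qs : seq nat) (b : nat) : Prop :=
  exists2 r, r \in qs & ow b = r.+1.

Lemma reached_cat qs qs' b : reached qs b -> reached (qs ++ qs') b.
Proof. by case=> r rq owb; exists r => //; rewrite mem_cat rq. Qed.

(** The queue only grows at its end, hence the form [qs ++ qs']; the list [qs'] is empty or consists
    of the owner of the visited element. *)
Lemma runs_visit qs s : searching qs s -> reg s r_row \in qs ->
  reg s r_j < deg (reg s r_row) -> reg s r_found = 0 ->
  runs Visit s 60 (fun s' =>
    [/\ reg s' r_row = reg s r_row, reg s' r_head = reg s r_head,
        reg s' r_j = (reg s r_j).+1
      & exists qs', searching (qs ++ qs') s' /\
          if reg s' r_found == 0 then reached (qs ++ qs') (adj (reg s r_row) (reg s r_j))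
          else edge (reg s r_row) (reg s' r_b) /\ ow (reg s' r_b) = 0]).
Proof.
move=> [gs smt sow stail squeue sseen tr] rq lt_j f0.
have [_ _ _ gadj] := gs; have lt_r := tree_lt tr rq.
set r := reg s r_row in rq lt_j lt_r *; set j := reg s r_j in lt_j *.
have e : edge r (adj r j) by exists j.
have eb : elem (adj r j) by exists r.
apply: runs_straight => //=; rewrite gadj // sow !addn1.
case owb: (ow (adj r j)) => [|o] /=.
  by split=> //; exists [::]; rewrite cats0.
have [lt_o mto] := mP.2 _ _ eb owb; rewrite subn1 /=.
have [seen0|seen] := eqVneq (arr s a_seen o) 0; last first.
  split=> //=; exists [::]; rewrite cats0; split=> //; rewrite f0 /=.
  by exists o; rewrite // -sseen.
have oq : o \notin qs by rewrite -sseen // seen0.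
split=> //=; exists [:: o]; rewrite f0 cats1 /=; split; last first.
  by exists o; rewrite // mem_rcons mem_head.
split=> //=.
- by rewrite size_rcons stail.
- move=> h; rewrite size_rcons ltnS nth_rcons stail leq_eqVlt.
  have [->|ne /= lt] := eqVneq h (size qs); first by rewrite ltnn.
  by rewrite lt squeue.
- move=> r' lt'; rewrite mem_rcons inE -sseen //.
  by have [->|] := eqVneq r' o.
exact: tree_push tr rq e lt_o oq mto.
Qed.

Definition explored (qs : seq nat) (n : nat) : Prop :=
  forall h b, h < n -> edge (nth 0 qs h) b -> reached qs b.

Definition search_state (s : state) : Prop :=
  exists qs, [/\ searching qs s, reg s r_head <= size qs
    & if reg s r_found == 0 then explored qs (reg s r_head)
      else [/\ reg s r_row \in qs, edge (reg s r_row) (reg s r_b)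
             & ow (reg s r_b) = 0]].

Lemma explored_cat qs qs' n : n <= size qs -> explored qs n -> explored (qs ++ qs') n.
Proof.
move=> le ex h b lt; rewrite nth_cat (leq_trans lt le) => e.
by apply: reached_cat; exact: ex e.
Qed.

Lemma runs_explore s : search_state s -> reg s r_head < reg s r_tail ->
  reg s r_found = 0 ->
  runs Explore s (80 * m + 40) (fun s' =>
    search_state s' /\ reg s' r_head = (reg s r_head).+1).
Proof.
move=> [qs [sq _]] + lt f0; rewrite f0 /= => ex.
have lt_h : reg s r_head < size qs by rewrite -(searching_tail sq).
apply: (@runs_straight_seq _ _ _ (80 * m + 10)) => //=; first lia.
rewrite (searching_queue sq) // addn1.
set r := nth 0 qs (reg s r_head); set s0 := set_reg _ _ _.
have rq : r \in qs by exact: mem_nth.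
have lt_r := tree_lt (searching_tree sq) rq.
pose pot s' := (deg r - reg s' r_j) * 80 + 10.
apply: (@runs_le _ _ (pot s0)); last first.
  by rewrite /pot /= subn0 leq_add2r mulnC leq_mul2l deg_le.
apply: (runs_while (I := fun s' => [/\ reg s' r_row = r,
  reg s' r_head = (reg s r_head).+1 & exists qs', [/\ searching (qs ++ qs') s',
    reg s' r_j <= deg r & if reg s' r_found == 0
      then forall j, j < reg s' r_j -> reached (qs ++ qs') (adj r j)
      else edge r (reg s' r_b) /\ ow (reg s' r_b) = 0]])).
- split=> //; exists [::]; rewrite cats0 /= f0; split=> //.
  by case: sq => ? ? ? ? ? ? ?; split.
- move=> s1 [row1 head1 [qs' [sq1 _]]] /=.
  have [_ _ gdeg _] := searching_graph sq1.
  rewrite row1 gdeg //; case f1: (reg s1 r_found) => [|f]; last by case: ltnP.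
  case: ltnP => //= lt_j reach _; exists 60.
  have row1q : reg s1 r_row \in qs ++ qs' by rewrite row1 mem_cat rq.
  have := runs_visit sq1 row1q; rewrite row1 => /(_ lt_j f1) H.
  apply: (runs_weaken H) => // s2 [row2 head2 j2 [qs2]]; rewrite -catA => -[sq2 out].
  split; last by rewrite /pot j2; lia.
  split=> //; first by rewrite head2.
  exists (qs' ++ qs2); rewrite j2; split=> //; case: eqP out => //= _ out j.
  rewrite ltnS leq_eqVlt => /predU1P[->//|/reach].
  by rewrite catA; exact: reached_cat.
move=> s1 [row1 head1 [qs' [sq1 le_j]]] /=; have [_ _ gdeg _] := searching_graph sq1.
rewrite row1 gdeg // => out stop; split; first by apply: leq_trans (leq_addl _ _).
split=> //; exists (qs ++ qs'); rewrite head1; split=> //.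
  by rewrite size_cat ltn_addr.
case: ifP out => [/eqP f1 reach|_ []]; last by rewrite row1 mem_cat rq.
move=> h b; rewrite ltnS leq_eqVlt => /predU1P[->|lt'].
  rewrite nth_cat lt_h -/r => -[j lt_j <-]; apply: reach.
  by move: stop; rewrite f1; case: (ltnP (reg s1 r_j) (deg r)) => // le; rewrite (leq_trans lt_j).
by apply: explored_cat ex _ _ lt'; exact: ltnW.
Qed.

End Search.

Lemma runs_search s : graph s -> matched (arr s a_mt) (arr s a_ow) ->
  reg s r_i < m -> arr s a_mt (reg s r_i) = 0 ->
  runs Search s (m * (80 * m + 80) + 100) (fun s' =>
    [/\ graph s', arr s' a_mt = arr s a_mt, arr s' a_ow = arr s a_ow
      & if reg s' r_found == 0 then ~ perfect
        else exists2 qs, tree (reg s r_i) (arr s' a_mt) (arr s' a_parent) qs &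
          [/\ reg s' r_row \in qs, edge (reg s' r_row) (reg s' r_b)
             & arr s' a_ow (reg s' r_b) = 0]]).
Proof.
move=> gs mP lt_i mti; set i := reg s r_i in lt_i mti *.
set mt := arr s a_mt in mP mti *; set ow := arr s a_ow in mP *.
apply: (@runs_le _ _ (m * (5 + 1 + 7) + 1 + 5 + (m * (80 * m + 60) + 60))); last by nia.
apply: runs_seq.
apply: (@runs_weaken _ _ (m * (5 + 1 + 7) + 1 + 5)) => //.
  apply: (runs_for (n := m) (I := fun j s' => [/\ graph s', arr s' a_mt = mt,
    arr s' a_ow = ow, reg s' r_i = i & forall r, r < j -> arr s' a_seen r = 0])).
  - by [].
  - by move=> j s' [[]].
  move=> j s' lt_j [gs' mt' ow' i' seen'] j'; apply: runs_straight => //=.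
  rewrite j'; split=> //; split=> //= r; rewrite ltnS leq_eqVlt.
  by case: eqP => //= _; exact: seen'.
move=> s1 [gs1 mt1 ow1 i1 seen1].
apply: (@runs_straight_seq _ _ _ (m * (80 * m + 60) + 10)) => //=; first lia.
rewrite i1; set s0 := set_reg _ _ _.
(* A row enters the queue at most once, so the head advances at most [m] times. *)
pose pot s' := (m - reg s' r_head) * (80 * m + 60) + 10.
apply: (@runs_le _ _ (pot s0)); last by rewrite /pot /= subn0.
apply: (runs_while (I := search_state i mt ow)).
- exists [:: i]; split=> //=.
  split=> //=; first by case=> //=.
    by move=> r lt; rewrite inE; have [//|_] := eqVneq r i; rewrite seen1.
  split=> //=; first by move=> r; rewrite inE => /eqP->.
  + by rewrite mem_head.
  + by move=> r; rewrite inE => /eqP.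
  by move=> r b; rewrite inE => /eqP->; rewrite mti.
- move=> s2 ss2 /= go; exists (80 * m + 40).
  have [qs [sq le_h _]] := ss2.
  have [lt f0] : reg s2 r_head < reg s2 r_tail /\ reg s2 r_found = 0.
    by move: go; case: ltnP; case: (reg s2 r_found).
  apply: (runs_weaken (runs_explore mP ss2 lt f0)) => // s3 [ss3 head3]; split=> //.
  move: lt; rewrite /pot head3 (searching_tail sq).
  by have := tree_size (searching_tree sq); nia.
move=> s2 [qs [sq le_h out]] /= stop; split; first by apply: leq_trans (leq_addl _ _).
have [gs2 mt2 ow2 tail2 queue2 seen2 tr2] := sq.
split=> //; rewrite mt2 ow2; case: eqP out stop => [->|_ out _]; last by exists qs.
rewrite tail2 subn0 => ex /eqP; rewrite eqb0 -leqNgt => ge.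
(* The queue is exhausted without a free element: every neighbour of a queued row is owned by a
   queued row, which obstructs a perfect matching. *)
apply: not_perfect mP (tree_uniq tr2) _ (tree_mem_root tr2) mti _.
  exact: tree_lt tr2.
move=> r b rq e; apply: (ex (index r qs)); last by rewrite nth_index.
by apply: leq_trans ge; rewrite index_mem.
Qed.

(** The loop goes on after a failure, but [r_ans] never returns to 1, and the budget limits the
    searches to [m %/ k.+1] in all cases. *)
Lemma runs_complete s : graph s -> matched (arr s a_mt) (arr s a_ow) ->
  (perfect -> k.+1 * unmatched (arr s a_mt) <= m) ->
  runs Complete s (m * 60 + m %/ k.+1 * (m * (80 * m + 120) + 150) + 30)
    (fun s' => reg s' r_ans <= 1 /\ (reg s' r_ans == 1 <-> perfect)).
Proof.
move=> gs mP un_le; set B := m * (80 * m + 120) + 150.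
apply: (@runs_straight_seq _ _ _ (m * 60 + m %/ k.+1 * B + 10)) => //=; first lia.
have [sm _ _ _] := gs; rewrite sm; set s0 := set_reg _ _ _.
pose pot s' := (m - reg s' r_i) * 60 + reg s' r_d %/ k.+1 * B + 10.
apply: (@runs_le _ _ (pot s0)); last by rewrite /pot /= subn0.
apply: (runs_while (I := fun s' => [/\ graph s' /\ reg s' r_i <= m,
  matched (arr s' a_mt) (arr s' a_ow),
  reg s' r_ans <= 1,
  perfect -> k.+1 * unmatched (arr s' a_mt) <= reg s' r_d
  & if reg s' r_ans == 0 then ~ perfect
    else forall r, r < reg s' r_i -> arr s' a_mt r != 0])).
- by split.
- move=> s1 [[gs1 _] mP1 ans1 un1 dn1] /=; have [-> k1 _ _] := gs1.
  rewrite eqb0 negbK => lt_i.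
  have [mt0|mt_nz] := eqVneq (arr s1 a_mt (reg s1 r_i)) 0; last first.
    exists 8; apply: (@runs_seq _ _ _ 4 4); apply: (@runs_if _ _ _ _ 1) => /= [_|e0]; last first.
      by rewrite e0 in mt_nz.
    apply: runs_straight => //; apply: runs_straight => //=; split; last first.
      by rewrite /pot /= addn1; lia.
    split=> //; first by rewrite addn1.
    case: ifP dn1 => // _ dn1 r; rewrite addn1 ltnS leq_eqVlt.
    by move=> /predU1P[->|/dn1].
  have [lt_d|ge_d] := ltnP k (reg s1 r_d); last first.
    exists 20; apply: (@runs_seq _ _ _ 16 4); apply: (@runs_if _ _ _ _ 13) => /= [nz|_].
      by rewrite mt0 in nz.
    apply: (@runs_if _ _ _ _ 9) => /= [|_]; first by rewrite k1 ltnNge ge_d.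
    apply: runs_straight => //; apply: runs_straight => //=; rewrite addn1.
    split; last by rewrite /pot /=; lia.
    split=> // /un1; have := unmatched_gt0 lt_i mt0; nia.
  exists (B - 4 + 4); apply: runs_seq.
  apply: (@runs_le _ _ ((cost (Get a_mt (Reg r_i))).+1 +
      ((cost (Ltn (Reg r_k) (Reg r_d))).+1 +
       (6 + (m * (80 * m + 80) + 100 + (2 + (40 * m + 2))))))).
    2: by rewrite /B /=; lia.
  apply: runs_if => /= [|_]; first by rewrite mt0.
  apply: runs_if => /= [_|]; last by rewrite k1 lt_d.
  apply: runs_seq; apply: runs_straight => //=; rewrite k1 addn1.
  set s2 := set_reg _ _ _; apply: runs_seq.
  have H := @runs_search s2 gs1 mP1 lt_i mt0.
  apply: (runs_weaken (runs_frame H)) => // s3 [[gs3 mt3 ow3 found3] fr3].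
  have [i3 d3 ans3] : [/\ reg s3 r_i = reg s1 r_i, reg s3 r_d = reg s1 r_d - k.+1
      & reg s3 r_ans = reg s1 r_ans].
    by split; exact: fr3.1.
  (* Taking [k.+1] from the budget lowers its quotient by [k.+1] by one, which releases the [B]
     units that pay for the search. *)
  have lt_pot d : d <= reg s1 r_d - k.+1 ->
      4 + (B - 4 + 4) + ((m - (reg s1 r_i).+1) * 60 + d %/ k.+1 * B + 10) <= pot s1.
    move=> le; have : d %/ k.+1 < reg s1 r_d %/ k.+1.
      rewrite (leq_ltn_trans (leq_div2r _ le)) // -[in X in _ < X](subnK lt_d).
      by rewrite divnDr ?dvdnn // divnn addn1.
    rewrite subnK; last by rewrite /B; lia.
    by rewrite /pot; nia.
  apply: (@runs_if _ _ _ _ (40 * m + 2)) => /= [f_nz|f0].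
    rewrite (negbTE f_nz) in found3; case: found3 => qs tr3 [rq e free].
    have H3 : matched (arr s3 a_mt) (arr s3 a_ow) by rewrite mt3 ow3.
    have root3 : arr s3 a_mt (reg s2 r_i) = 0 by rewrite mt3.
    apply: (runs_weaken (runs_frame (runs_augment tr3 H3 root3 rq e free f_nz))) => //.
    move=> s4 [[mP4 root4 same4] fr4].
    have gs4 : graph s4 by exact: graph_frame fr4 _ _ gs3.
    have [i4 d4 ans4] : [/\ reg s4 r_i = reg s3 r_i, reg s4 r_d = reg s3 r_d
        & reg s4 r_ans = reg s3 r_ans].
      by split; exact: fr4.1.
    apply: runs_straight => //=; rewrite addn1 i4 i3.
    (* The augmentation matches exactly one more row, so both sides of the budget inequality drop by
       [k.+1]. *)
    have un4 : unmatched (arr s1 a_mt) = (unmatched (arr s4 a_mt)).+1.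
      apply: unmatched_augment lt_i mt0 root4 _ => r ne.
      by rewrite same4 // mt3.
    split; last by rewrite /pot /= d4 d3; exact: lt_pot.
    split=> //=; rewrite ?ans4 ?ans3 ?d4 ?d3 //.
      by move=> /un1; rewrite un4; nia.
    case: ifP dn1 => // _ dn1 r; rewrite ltnS leq_eqVlt.
    have [-> _|ne /=] := eqVneq r (reg s1 r_i); first exact: root4.
    by rewrite same4 // mt3; exact: dn1.
  rewrite f0 /= in found3; apply: runs_straight => //; first exact: leq_addl.
  apply: runs_straight => //=.
  rewrite addn1 i3; split; last by rewrite /pot /= d3; exact: lt_pot.
  by split=> //=; rewrite mt3 ow3.
move=> s1 [[gs1 le_i] mP1 ans1 un1 dn1] /=; have [-> _ _ _] := gs1 => /eqP.
rewrite eqb0 -leqNgt => ge_i; split; first by apply: leq_trans (leq_addl _ _).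
split=> //; move: ans1 dn1; case: (reg s1 r_ans) => [|[|]] //= _ dn1.
by split=> // _; apply: matched_perfect mP1 _ => r lt; apply: dn1; exact: leq_trans ge_i.
Qed.

End Correctness.

(** * Integer square root and prefix lengths *)

Lemma exists_square_ge m : exists k, m <= k * k.
Proof. by exists m; nia. Qed.

Definition ceil_sqrt m := ex_minn (exists_square_ge m).

Lemma runs_sqrt s : runs Sqrt s (16 * ceil_sqrt (reg s r_m) + 10)
  (fun s' => reg s' r_k = ceil_sqrt (reg s r_m)).
Proof.
set m := reg s r_m; rewrite /ceil_sqrt; case: ex_minnP => k le_k min_k.
apply: (@runs_straight_seq _ _ _ (16 * k + 5)) => //=; first lia.
set s0 := set_reg _ _ _; pose pot s' := 16 * (k - reg s' r_k) + 5.
apply: (@runs_le _ _ (pot s0)); last by rewrite /pot /= subn0.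
apply: (runs_while (I := fun s' => [/\ reg s' r_m = m,
  reg s' r_d = reg s' r_k * reg s' r_k & reg s' r_k <= k])) => //.
- move=> s1 [sm sd le1] /=; rewrite sm sd eqb0 negbK => lt; exists 12.
  have lt1 : reg s1 r_k < k by nia.
  apply: runs_straight => //; split; last by rewrite /pot /= addn1; lia.
  by split=> //=; rewrite ?sd addn1 //; nia.
move=> s1 [sm sd le1] /=; rewrite sm sd => /eqP; rewrite eqb0 -leqNgt => /min_k ge.
by split; [apply: leq_trans (leq_addl _ _) | apply/eqP; rewrite eqn_leq le1].
Qed.

(** The recurrence that [Setup] computes in [r_d]: the index of an absent value is the length, so
    equality with [j] says that [x] has not occurred so far. *)
Lemma index_mkseqS x (f : nat -> nat) j : index x (mkseq f j.+1) =
  if (j == index x (mkseq f j)) && (f j != x) then j.+1 else index x (mkseq f j).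
Proof.
rewrite mkseqS -cats1 index_cat size_mkseq /=.
have := index_mem x (mkseq f j); rewrite size_mkseq.
case: ifP => [_ lt|/negbT xin _]; first by rewrite gtn_eqF.
rewrite memNindex // size_mkseq eqxx /=.
by case: eqP; rewrite /= ?addn0 ?addn1.
Qed.

(** * The graph of the entries that precede a given element *)

Section Avoid.

Variables (m l x : nat) (adj : nat -> nat -> nat).

Definition loaded (s : state) : Prop :=
  [/\ reg s r_m = m, reg s r_l = l, reg s r_x = x
    & forall i j, i < m -> j < m -> arr s a_in (i * l + j) = adj i j].

(** When [x] is not among the first [m] entries of the row, [index] returns [m] and all these
    entries are kept. *)
Definition prefix_size (i : nat) : nat := index x (mkseq (adj i) m).

Lemma prefix_size_le i : prefix_size i <= m.
Proof. by rewrite -[X in _ <= X](size_mkseq (adj i)) index_size. Qed.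

Lemma lt_prefix_size i j :
  j < m -> (forall j', j' <= j -> adj i j' != x) -> j < prefix_size i.
Proof.
move=> lt_j ne; rewrite ltnNge; apply/negP=> le.
have lt : prefix_size i < m by exact: leq_ltn_trans lt_j.
have : x \in mkseq (adj i) m by rewrite -index_mem size_mkseq.
by move=> /(nth_index 0); rewrite nth_mkseq // => /eqP; rewrite (negbTE (ne _ le)).
Qed.

Lemma prefix_size_neq i j : j < prefix_size i -> adj i j != x.
Proof.
move=> lt; have := before_find 0 lt; rewrite nth_mkseq => [/negbT//|].
exact: leq_trans (prefix_size_le i).
Qed.

Definition cleared (s : state) (b : nat) : Prop := arr s a_ow b = 0 /\ arr s a_pr b = 0.

Lemma runs_setup s k : loaded s -> reg s r_k = k ->
  runs Setup s (m * (m * 50 + 60) + 10) (fun s' =>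
    [/\ graph m k prefix_size adj s', forall r, r < m -> arr s' a_mt r = 0
      & forall b, elem m prefix_size adj b -> cleared s' b]).
Proof.
move=> ls sk.
apply: (@runs_straight_seq _ _ _ (m * (m * 50 + 40 + 1 + 7) + 1 + 5)) => //=; first lia.
pose I i s' := [/\ loaded s', reg s' r_k = k, reg s' r_off = i * l,
  forall i', i' < i -> [/\ arr s' a_off i' = i' * l, arr s' a_mt i' = 0
    & arr s' a_deg i' = prefix_size i']
  & forall i' j, i' < i -> j < m -> cleared s' (adj i' j)].
apply: (runs_weaken (Q := I m) _ (leqnn _)); last first.
  move=> s' [[sm _ _ cells] sk' _ row clr]; split.
  - split=> // [r|r j] lt; first by case: (row r lt).
    move=> lt_j; have [-> _ _] := row r lt.
    by rewrite cells // (leq_trans lt_j) // prefix_size_le.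
  - by move=> r lt; case: (row r lt).
  move=> b [r lt [j lt_j <-]]; apply: clr => //.
  by rewrite (leq_trans lt_j) // prefix_size_le.
apply: (runs_for (n := m) (I := I)) => //; first by move=> j s' [[]].
move=> i s1 lt_i [ls1 k1 off1 row1 clr1] i1.
apply: (@runs_straight_seq _ _ _ (m * (30 + 1 + 7) + 1 + 5 + 10)) => //=; first lia.
rewrite i1 off1; set s2 := set_reg _ _ _; apply: runs_seq.
apply: runs_weaken (leqnn _) _.
{ apply: (runs_for (n := m) (I := fun j s' => [/\
    [/\ loaded s', reg s' r_k = k, reg s' r_off = i * l & reg s' r_i = i],
    [/\ arr s' a_off = upd (arr s1 a_off) i (i * l),
        arr s' a_mt = upd (arr s1 a_mt) i 0 & arr s' a_deg = arr s1 a_deg],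
    reg s' r_d = index x (mkseq (adj i) j),
    forall b, cleared s1 b -> cleared s' b
    & forall j', j' < j -> cleared s' (adj i j')])).
  - by split.
  - by move=> j s' [[[]]].
  move=> j s3 lt_j [[[sm sl sx cells] k3 off3 i3] [aoff amt adeg] d3 keep clr3] j3.
  move: (index_mkseqS x (adj i) j); set ind := index x (mkseq _ j.+1) => ind_eq.
  apply: runs_straight => //=; rewrite off3 j3 cells // sx d3 addn1 ind_eq !eqb0.
  (* Only zeros are written to owners and prices, so a cleared cell stays cleared when its element
     occurs again. *)
  have clr_upd b : cleared s3 b \/ b = adj i j ->
      (if b == adj i j then 0 else arr s3 a_ow b) = 0 /\
      (if b == adj i j then 0 else arr s3 a_pr b) = 0.
    by case: eqP => // _ [[]|//].
  have clr_row j' : j' < j.+1 -> cleared s3 (adj i j') \/ adj i j' = adj i j.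
    rewrite ltnS leq_eqVlt => /predU1P[->|/clr3]; by [right | left].
  case: (j =P index x _) => [eqj|_] /=; [case: (adj i j == x) => /=|]; split=> //; split=> //.
  all: by [rewrite -eqj | move=> b /keep cb; apply: clr_upd; left
    | move=> j' /clr_row; exact: clr_upd]. }
move=> s3 [[ls3 k3 off3 i3] [aoff amt adeg] d3 keep clr3].
have [_ sl3 _ _] := ls3; apply: runs_straight => //=.
split=> //; split=> //=; first by rewrite off3 sl3 mulSn addnC.
- move=> i'; rewrite i3 d3 aoff amt adeg ltnS leq_eqVlt.
  have [-> _|ne /= lt] := eqVneq i' i; first by rewrite !upd_same.
  by rewrite !upd_other //; exact: row1.
move=> i' j; rewrite ltnS leq_eqVlt => /predU1P[->|lt] lt_j; first exact: clr3.
by apply/keep/clr1.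
Qed.

Definition avoid_time (n : nat) : nat := 1000 * (n * n * ceil_sqrt n) + 100.

Lemma runs_avoid s : loaded s ->
  runs Avoid s (avoid_time m) (fun s' =>
    reg s' r_ans <= 1 /\ (reg s' r_ans == 1 <-> perfect m prefix_size adj)).
Proof.
move=> ls; have sm : reg s r_m = m by case: ls.
set k := ceil_sqrt m.
apply: (@runs_le _ _ ((16 * k + 10) + ((m * (m * 50 + 60) + 10) +
  (((k * m + m) * (40 * m + 110) + 20) +
   (m * 60 + m %/ k.+1 * (m * (80 * m + 120) + 150) + 30))))); last first.
  rewrite /avoid_time /k; case: (posnP m) => [->|m_gt0].
    by rewrite /ceil_sqrt; case: ex_minnP => k' _ /(_ 0 isT); rewrite leqn0 => /eqP->.
  (* As [m] is at most the square of [ceil_sqrt m], no more searches than [ceil_sqrt m] are made;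
     this balances their cost with that of the auction. *)
  have [k_gt0 le_k] : 0 < ceil_sqrt m /\ m %/ (ceil_sqrt m).+1 <= ceil_sqrt m.
    rewrite /ceil_sqrt; case: ex_minnP => k' le_k' _; split; first by nia.
    by rewrite -ltnS ltn_divLR //; nia.
  move: (ceil_sqrt m) (m %/ _) k_gt0 le_k => k' q k_gt0 le_q; nia.
apply: runs_seq; apply: (runs_weaken (runs_frame (@runs_sqrt s))); rewrite ?sm // => s1 [k1 fr1].
have ls1 : loaded s1.
  case: ls => *; split; rewrite ?fr1.1 // => i j lti ltj; rewrite fr1.2 //; auto.
apply: runs_seq; apply: (runs_weaken (runs_setup ls1 k1)) => // s2 [gs2 mt2 clr2].
have le r : r < m -> prefix_size r <= m by move=> _; exact: prefix_size_le.
apply: runs_seq; apply: (runs_weaken (runs_auction le gs2 mt2 clr2)) => // s3 [gs3 mP3 un3].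
exact: runs_complete.
Qed.

End Avoid.

(** * Enumeration of the candidates by a greedy choice *)

Section Listing.

Variables (m l : nat) (adj : nat -> nat -> nat) (avoid : nat -> bool).
Hypothesis row_uniq : forall i, i < m -> uniq (mkseq (adj i) m).
Hypothesis avoidP : forall i j, i < m -> j < m ->
  avoid (adj i j) <-> perfect m (prefix_size m (adj i j) adj) adj.

(** The outcome of serial dictatorship. The entries preferred to a chosen one are only required to
    occur somewhere in [g], a condition that survives extending [g]. *)
Definition greedy (g : seq nat) : Prop :=
  uniq g /\ forall i, i < size g -> exists2 w, w < m &
    nth 0 g i = adj i w /\ forall w', w' < w -> adj i w' \in g.

Lemma greedy_rcons g w : greedy g -> w < m -> adj (size g) w \notin g ->
  (forall w', w' < w -> adj (size g) w' \in g) -> greedy (rcons g (adj (size g) w)).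
Proof.
move=> [g_uniq gP] lt_w new old; split; first by rewrite rcons_uniq new.
move=> i; rewrite size_rcons ltnS leq_eqVlt => /predU1P[->|lt_i].
  exists w => //; rewrite nth_rcons ltnn eqxx; split=> // w' /old.
  by rewrite mem_rcons inE orbC => ->.
have [w0 lt0 [nthE old0]] := gP i lt_i; exists w0 => //.
rewrite nth_rcons lt_i; split=> // w' /old0.
by rewrite mem_rcons inE orbC => ->.
Qed.

(** Each chosen entry and everything before it in its row lie in [g], hence differ from [x]; so [g]
    itself is a matching within the prefixes. *)
Lemma greedy_perfect g x : greedy g -> size g = m -> x \notin g ->
  perfect m (prefix_size m x adj) adj.
Proof.
move=> [g_uniq gP] sz xg; exists (nth 0 g); split=> [r lt|r r' lt lt' /eqP].
  have [|w lt_w [gE old]] := gP r; first by rewrite sz.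
  exists w => //; apply: lt_prefix_size => // w'; rewrite leq_eqVlt.
  move=> /predU1P[->|/old]; last by apply: contraTneq => ->.
  by apply: contraNneq xg => <-; rewrite -gE mem_nth // sz.
by rewrite nth_uniq ?sz // => /eqP.
Qed.

Definition listing_time : nat := m * (m * 20 + avoid_time m + 100) + 20.

Lemma runs_listing s : reg s r_m = m -> reg s r_l = l ->
  (forall i j, i < m -> j < m -> arr s a_in (i * l + j) = adj i j) ->
  (forall c, arr s a_taken c = 0) ->
  runs Listing s listing_time (fun s' => exists g, [/\ greedy g, size g = m
    & mkseq (arr s' a_out) (reg s' 0) = [seq c <- g | ~~ avoid c]]).
Proof.
move=> sm sl cells taken0.
apply: (@runs_straight_seq _ _ _ ((m * ((m * 20 + avoid_time m + 50) + 1 + 7) + 1 + 5) + 2)) => //=.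
  by rewrite /listing_time; nia.
set s0 := set_reg _ _ _; apply: runs_seq.
pose I y s' := [/\ reg s' r_m = m, reg s' r_l = l, reg s' r_z = y * l,
  arr s' a_in = arr s a_in & exists g, [/\ greedy g, size g = y,
    forall c, (arr s' a_taken c != 0) = (c \in g)
  & mkseq (arr s' a_out) (reg s' r_c) = [seq c <- g | ~~ avoid c]]].
apply: (runs_weaken (Q := I m) _ (leqnn _)); last first.
  by move=> s1 [_ _ _ _ [g [gg sz _ outE]]]; apply: runs_straight => //; exists g.
apply: (runs_for (n := m) (I := I)); first 2 last.
- move=> y s1 lt_y [m1 l1 z1 in1 [g [gg sz taken outE]]] y1.
  apply: (@runs_straight_seq _ _ _ ((m * 20 + 6) + (avoid_time m + 40))) => //=; first lia.
  set s2 := set_reg _ _ _.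
  pose J s' := [/\
    [/\ reg s' r_m = m, reg s' r_l = l, reg s' r_y = y & reg s' r_c = reg s1 r_c],
    reg s' r_z = y * l, arr s' = arr s1, reg s' r_w < m
    & forall w, w < reg s' r_w -> adj y w \in g].
  pose pot s' := (m - reg s' r_w) * 20 + 6.
  (* Pigeonhole: the [m] distinct entries of the row cannot all lie in [g], which has [y < m]
     members, so the scan stops within the first [m] columns. *)
  have not_all w : w <= m -> (forall w', w' < w -> adj y w' \in g) -> w < m.
    rewrite leq_eqVlt => /predU1P[->|//] old; have := uniq_leq_size (s2 := g) (row_uniq lt_y).
    rewrite size_mkseq sz leqNgt lt_y => absurd; suff : false by [].
    by apply: absurd => c /mapP[w']; rewrite mem_iota => /old wg ->.
  apply: runs_seq; apply: (@runs_weaken _ _ (pot s2) _ (fun s' => J s' /\ adj y (reg s' r_w) \notin g)).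
  + apply: (runs_while (I := J)).
    * by split=> //=; apply: not_all.
    * move=> s3 [[m3 l3 y3 c3] z3 a3 lt_w old] /=; rewrite z3 a3 in1 cells // taken => win.
      exists 4; apply: runs_straight => //=; rewrite addn1.
      have old' w : w < (reg s3 r_w).+1 -> adj y w \in g.
        by rewrite ltnS leq_eqVlt => /predU1P[->|/old].
      split; last by rewrite /pot /=; lia.
      by split=> //=; apply: not_all.
    move=> s3 J3; have [_ z3 a3 lt_w _] := J3; rewrite /= z3 a3 in1 cells // => free.
    by split; [apply: leq_trans (leq_addl _ _) | split; rewrite // -taken free].
  + by rewrite /pot /= subn0.
  move=> s3 [[[m3 l3 y3 c3] z3 a3 lt_w old] new].
  apply: (@runs_straight_seq _ _ _ (avoid_time m + 30)) => //=; first lia.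
  rewrite z3 a3 in1 cells //; set c := adj y (reg s3 r_w); set s4 := set_arr _ _ _ _.
  have loaded4 : loaded m l c adj s4.
    by split=> //= i j lti ltj; rewrite a3 in1 cells.
  apply: runs_seq; apply: (runs_weaken (runs_frame (runs_avoid loaded4))) => //.
  move=> s5 [[ans5 ansP] fr5].
  have ansE : (reg s5 r_ans == 0) = ~~ avoid c.
    have eqp := avoidP lt_y lt_w; apply/idP/idP.
      by move=> /eqP e; apply/negP => /eqp /ansP; rewrite e.
    by move: ans5 ansP; case: (reg s5 r_ans) => [|[|]] //= _ [/(_ isT) p _]; case/negP; apply/eqp.
  have fr x : x \in [:: 0; 2; 3; 20; 21; 22; 23] -> reg s5 x = reg s4 x.
    by move=> xin; apply: fr5.1; move: x xin; apply/allP.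
  have fa a : a \in [:: 0; 1; 10] -> arr s5 a = arr s4 a.
    by move=> ain; apply: fr5.2; move: a ain; apply/allP.
  apply: runs_straight => //=; rewrite ansE.
  have taken5 d : (arr s5 a_taken d != 0) = (d \in rcons g c).
    rewrite fa // mem_rcons inE /= -taken -a3; by have [->|] := eqVneq d c.
  have [gg' sz'] : greedy (rcons g c) /\ size (rcons g c) = y.+1.
    by rewrite size_rcons sz; split=> //; rewrite /c -sz; apply: greedy_rcons; rewrite ?sz.
  have [m5 l5 y5] : [/\ reg s5 r_m = m, reg s5 r_l = l & reg s5 r_y = y].
    by rewrite !fr.
  have [z5 c5 x5] : [/\ reg s5 r_z = y * l, reg s5 r_c = reg s1 r_c & reg s5 r_x = c].
    by rewrite !fr.
  have [in5 out5] : arr s5 a_in = arr s a_in /\ arr s5 a_out = arr s1 a_out.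
    by rewrite !fa //= a3.
  case av: (avoid c) => /=; split=> //; split=> //=; try by rewrite z5 l5 mulSn addnC.
    by exists (rcons g c); split=> //; rewrite filter_rcons av /= -outE c5 out5.
  exists (rcons g c); split=> //; rewrite filter_rcons av /= -outE c5 addn1 mkseqS eqxx.
  rewrite x5; congr rcons; apply/eq_in_map => d; rewrite mem_iota /= => lt.
  by rewrite ltn_eqF // out5.
- by split=> //; exists [::]; split=> // c; rewrite taken0.
by move=> y s' [].
Qed.

End Listing.

(** * Preference matrices *)

Section Avoidable.

Variables (B : finType) (m l : nat) (M : 'M[B]_(m, l)).
Hypotheses (le_ml : m <= l) (M_pref : preference_matrix M).

Lemma code_inj : injective (@code B).
Proof. by move=> x y /val_inj/enum_rank_inj. Qed.

Lemma row_inj r : injective (M r).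
Proof. by move/forallP: M_pref => /(_ r)/injectiveP. Qed.

Definition cell (i j : nat) : nat := arr (input M 0) 0 (i * l + j).

Lemma cell_code (i : 'I_m) (j : 'I_l) : cell i j = code (M i j).
Proof.
rewrite /cell /=; set f := fun i j => code (M i j).
have nth_row (s : seq 'I_m) a : a < size s ->
    nth 0 [seq f i j | i <- s, j <- enum 'I_l] (a * l + j) = f (nth i s a) j.
  elim: s a => // i0 s IHs a; rewrite nth_cat size_map size_enum_ord.
  case: a => [_|a]; rewrite ?mul0n ?add0n ?ltn_ord /=.
    by rewrite (nth_map j) ?size_enum_ord // nth_ord_enum.
  rewrite ltnS => lt; rewrite mulSn -addnA ltnNge leq_addr /= addKn.
  exact: IHs.
by rewrite nth_row ?size_enum_ord // nth_ord_enum.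
Qed.

Local Notation perfect x := (perfect m (prefix_size m (code x) cell) cell).

(* Otherwise the row alone would block. *)
Lemma pom_better_selected tau r (j k : 'I_l) : pom M tau ->
  tau r = M r j -> k < j -> M r k \in selected tau.
Proof.
move=> /andP[/andP[tau_inj /forallP tau_row] /existsPn nb] tau_r lt_kj.
apply/negPn/negP => free; case/negP: (nb [set r]).
apply/andP; split; first by apply/set0Pn; exists r; rewrite inE.
have unsel r' : tau r' != M r k.
  by apply: contraNneq free => <-; apply: imset_f.
apply/existsP; exists [ffun r' => if r' == r then M r k else tau r'].
apply/and3P; split.
- apply/andP; split; last first.
    apply/forallP=> r'; rewrite ffunE; case: eqP => [->|_]; last exact: tau_row.
    by apply/existsP; exists k.
  apply/injectiveP=> r1 r2; rewrite !ffunE.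
  case: eqP => [->|_]; case: eqP => [->|_] //.
  + by move=> /eqP; rewrite eq_sym (negbTE (unsel _)).
  + by move=> /eqP; rewrite (negbTE (unsel _)).
  exact: (injectiveP _ tau_inj).
- by apply/forallP=> r'; rewrite inE ffunE; apply/implyP=> /negbTE->.
apply/forallP=> r'; apply/implyP; rewrite inE ffunE => /eqP->; rewrite eqxx.
by apply/existsP; exists k; apply/existsP; exists j; rewrite lt_kj eqxx tau_r /=.
Qed.

(** A Pareto optimal matching that misses [x] is itself the required one: all entries up to the
    chosen one are selected, so [x] is not among them. *)
Lemma avoidable_perfect x : avoidable M x -> perfect x.
Proof.
move=> /existsP[tau /andP[tau_pom xtau]].
have /andP[/andP[/injectiveP tau_inj /forallP tau_row] _] := tau_pom.
(* The value 0 only makes the function total; it is never taken below [m]. *)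
exists (fun r => if insub r is Some i then code (tau i) else 0).
split=> [r lt|r r' lt lt']; last first.
  rewrite !insubT /= => /code_inj/tau_inj eqr.
  by have := congr1 val eqr.
rewrite insubT; set i := Ordinal lt.
have /existsP[j /eqP tau_i] := tau_row i.
have sel (k : 'I_l) : k <= j -> M i k \in selected tau.
  rewrite leq_eqVlt => /predU1P[/val_inj->|]; first by rewrite tau_i imset_f.
  by apply: pom_better_selected tau_pom _; rewrite tau_i.
exists j; last by rewrite (cell_code i) tau_i.
(* The [j.+1] entries up to column [j] are distinct and selected, while at most [m] elements are
   selected. *)
have lt_jm : j < m.
  pose g (k : 'I_j.+1) := M i (widen_ord (ltn_ord j) k).
  have g_inj : injective g.
    by move=> k k' eqg; apply/val_inj; exact: (congr1 val (@row_inj i _ _ eqg)).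
  rewrite -[j.+1]card_ord -(card_imset predT g_inj) -[X in _ <= X]card_ord.
  rewrite (leq_trans _ (leq_imset_card tau predT)) // subset_leq_card //.
  by apply/subsetP=> _ /imsetP[k _ ->]; apply: sel; rewrite /= -ltnS.
apply: lt_prefix_size => // j' le_j'.
pose k : 'I_l := Ordinal (leq_ltn_trans le_j' (ltn_ord j)).
rewrite -[j']/(val k) (cell_code i) (inj_eq code_inj).
by apply: contraNneq xtau => <-; exact: sel.
Qed.

(* Among the matchings that give every row an element before [x], one whose
   total rank is minimal is Pareto optimal. *)
Lemma perfect_avoidable x : perfect x -> avoidable M x.
Proof.
move=> [f [f_edge f_inj]].
pose good (p : {ffun 'I_m -> 'I_l}) :=
  [forall r, p r < prefix_size m (code x) cell r] && injectiveb (fun r => M r (p r)).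
have [p0 p0_good] : exists p, good p.
  have edgeP (r : 'I_m) : exists j : 'I_l, (j < prefix_size m (code x) cell r) &&
      (cell r j == f r).
    have [j lt <-] := f_edge r (ltn_ord r).
    have lt_jl : j < l by rewrite (leq_trans lt) // (leq_trans (prefix_size_le _ _ _ _)).
    by exists (Ordinal lt_jl); rewrite lt eqxx.
  exists [ffun r => xchoose (edgeP r)]; apply/andP; split.
    by apply/forallP=> r; rewrite ffunE; have /andP[] := xchooseP (edgeP r).
  apply/injectiveP=> r r' /(congr1 (@code B)); rewrite !ffunE -!cell_code.
  have /andP[_ /eqP->] := xchooseP (edgeP r); have /andP[_ /eqP->] := xchooseP (edgeP r').
  by move=> /f_inj; rewrite !ltn_ord => /(_ isT isT)/val_inj.
case: (arg_minnP (fun p : {ffun 'I_m -> 'I_l} => \sum_r p r) p0_good).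
move=> p /andP[/forallP p_lt /injectiveP p_inj] p_min.
apply/existsP; exists [ffun r => M r (p r)]; apply/andP; split; last first.
  apply/imsetP=> -[r _]; rewrite ffunE => eqx.
  by have := prefix_size_neq (p_lt r); rewrite cell_code -eqx eqxx.
apply/andP; split.
  apply/andP; split; first by apply/injectiveP=> r r'; rewrite !ffunE; exact: p_inj.
  by apply/forallP=> r; apply/existsP; exists (p r); rewrite ffunE.
apply/existsPn=> A; apply/negP=> /andP[/set0Pn[a aA]] /existsP[tau'].
case/and3P=> /andP[/injectiveP tau'_inj _] /forallP out /forallP better.
(* The columns chosen by [tau'] are nowhere larger than those of [p], so they stay before [x], and
   they are strictly smaller on [A]: this contradicts the minimality of [p]. *)
have betterP r : exists j : 'I_l, [&& M r j == tau' r, j <= p r & (r \in A) ==> (j < p r)].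
  have [rA|rA] := boolP (r \in A); last first.
    by exists (p r); have := out r; rewrite rA ffunE /= => /eqP->; rewrite eqxx leqnn.
  have := better r; rewrite rA ffunE => /existsP[j /existsP[k /and3P[lt eqj /eqP/row_inj eqk]]].
  by exists j; rewrite eqj /= -eqk lt ltnW.
pose q := [ffun r => xchoose (betterP r)].
have qP r : [&& M r (q r) == tau' r, q r <= p r & (r \in A) ==> (q r < p r)].
  by rewrite ffunE; exact: (xchooseP (betterP r)).
have q_good : good q.
  apply/andP; split.
    apply/forallP=> r; apply: leq_ltn_trans (p_lt r); by have /and3P[] := qP r.
  apply/injectiveP=> r r'; have /and3P[/eqP-> _ _] := qP r.
  by have /and3P[/eqP-> _ _] := qP r'; exact: tau'_inj.
have := p_min q q_good; rewrite leqNgt => /negP; apply.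
rewrite (bigD1 a) //= [X in _ < X](bigD1 a) //= -addSn leq_add //.
  by have /and3P[_ _] := qP a; rewrite aA.
by apply: leq_sum => r _; have /and3P[] := qP r.
Qed.

End Avoidable.

(** * The two programs on encoded preference matrices *)

Lemma decide_correct (B : finType) (m l : nat) (M : 'M[B]_(m, l)) (x : B) :
  m <= l -> preference_matrix M ->
  runs Decide (input M (code x)) (avoid_time m + 2)
    (fun s => reg s 0 = avoidable M x).
Proof.
move=> le_ml M_pref; apply: runs_seq.
have loaded_in : loaded m l (code x) (cell M) (input M (code x)) by [].
apply: (runs_weaken (runs_avoid loaded_in)) => // s [ans ansP].
apply: runs_straight => //=; move: ans ansP; case: (reg s 5) => [|[|]] //= _ [p1 p2].
  by case: (boolP (avoidable M x)) => // /(avoidable_perfect M_pref)/p2.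
by rewrite (perfect_avoidable le_ml M_pref (p1 isT)).
Qed.

Lemma listing_correct (B : finType) (m l : nat) (M : 'M[B]_(m, l)) :
  m <= l -> preference_matrix M ->
  runs Listing (input M 0) (listing_time m) (fun s =>
    perm_eq (mkseq (arr s 1) (reg s 0)) [seq code x | x <- enum B & unavoidable M x]).
Proof.
move=> le_ml M_pref.
have cellP i j : i < m -> j < m -> exists x : B, cell M i j = code x.
  by move=> lti ltj; exists (M (Ordinal lti) (widen_ord le_ml (Ordinal ltj))); rewrite -cell_code.
pose avoid c := [exists x : B, (code x == c) && avoidable M x].
have avoidE x : avoid (code x) = avoidable M x.
  apply/existsP/idP => [[y /andP[/eqP/code_inj->]] //|av].
  by exists x; rewrite eqxx.
have unavE x : unavoidable M x = ~~ avoidable M x.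
  by rewrite negb_exists; apply: eq_forallb => tau; rewrite negb_and negbK implybE.
have row_uniq i : i < m -> uniq (mkseq (cell M i) m).
  move=> lt; rewrite map_inj_in_uniq ?iota_uniq // => j j'.
  rewrite !mem_iota /= => ltj ltj'.
  have := cell_code M (Ordinal lt) (widen_ord le_ml (Ordinal ltj)).
  have := cell_code M (Ordinal lt) (widen_ord le_ml (Ordinal ltj')) => /= -> ->.
  by move=> /code_inj/(row_inj M_pref)/(congr1 val).
have avoidP i j : i < m -> j < m ->
    avoid (cell M i j) <-> perfect m (prefix_size m (cell M i j) (cell M)) (cell M).
  move=> lti ltj; have [x ->] := cellP i j lti ltj; rewrite avoidE.
  by split; [exact: avoidable_perfect | exact: perfect_avoidable].
have run := @runs_listing m l (cell M) avoid row_uniq avoidP (input M 0)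
  erefl erefl (fun _ _ _ _ => erefl) (fun=> erefl).
apply: (runs_weaken run) => // s [g [gg sz ->]].
apply: uniq_perm.
- by rewrite filter_uniq //; case: gg.
- by rewrite (map_inj_uniq (@code_inj B)) filter_uniq // enum_uniq.
move=> c; rewrite mem_filter; apply/andP/mapP => [[nav cg]|[x]].
  have [i lt_i eqc] := nthP 0 cg; have [w lt_w [cE _]] := gg.2 i lt_i.
  rewrite sz in lt_i; have [x xE] := cellP i w lt_i lt_w.
  have cx : c = code x by rewrite -eqc cE.
  by exists x; rewrite // mem_filter unavE -avoidE -cx nav mem_enum.
rewrite mem_filter unavE => /andP[nav _] ->; rewrite avoidE; split=> //.
(* An unavoidable element cannot be missed, since every element outside the greedy choice is
   avoidable. *)
apply: contraNT nav => /(greedy_perfect gg sz).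
exact: perfect_avoidable.
Qed.

(** A single row already exhibits [l] distinct elements. *)
Lemma elements_ge (B : finType) (m l : nat) (M : 'M[B]_(m, l)) :
  m <= l -> preference_matrix M -> 0 < m -> m <= #|B|.
Proof.
move=> le_ml M_pref m_gt0; apply: leq_trans le_ml _.
by rewrite -[l]card_ord; apply: leq_card; exact: row_inj M_pref (Ordinal m_gt0).
Qed.

(** By minimality the square of the predecessor is below [m], and a number above 1 is at most twice
    its predecessor. *)
Lemma ceil_sqrt_sqr_le m : ceil_sqrt m * ceil_sqrt m <= 4 * m.
Proof.
rewrite /ceil_sqrt; case: ex_minnP => k _ min_k.
case: k min_k => [//|k] min_k.
have : k * k < m by rewrite ltnNge; apply/negP => /min_k; rewrite ltnn.
nia.
Qed.

(** The terms [20 m^2] and [200 m] are absorbed into the leading one, whence 1220 = 1000 + 20 +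
    200. *)
Lemma listing_time_le m :
  listing_time m <= 1220 * (m * m * m * ceil_sqrt m) + 20.
Proof.
rewrite /listing_time /avoid_time; case: (posnP m) => [->//|m_gt0].
have : 0 < ceil_sqrt m by rewrite /ceil_sqrt; case: ex_minnP => -[|k] // le0 _; lia.
move: (ceil_sqrt m) => k k_gt0.
have sqr_ge : m * m <= m * m * m * k by rewrite -mulnA leq_pmulr // muln_gt0 m_gt0.
have : m <= m * m by rewrite leq_pmulr.
lia.
Qed.

(** * Comparison with the real-valued time bounds *)

Local Open Scope ring_scope.

Section RealBounds.

Variable R : realType.

Lemma ceil_sqrt_le (m : nat) : (ceil_sqrt m)%:R <= 2 * Num.sqrt m%:R :> R.
Proof.
rewrite -ler_sqr ?nnegrE ?mulr_ge0 ?sqrtr_ge0 // exprMn sqr_sqrtr //.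
by rewrite expr2 -natrM -natrX -natrM ler_nat ceil_sqrt_sqr_le.
Qed.

Lemma sqrt_nat_le (m : nat) : Num.sqrt m%:R <= m%:R :> R.
Proof.
rewrite -ler_sqr ?nnegrE ?sqrtr_ge0 // sqr_sqrtr // -natrX ler_nat.
by rewrite expnS expn1; nia.
Qed.

Lemma avoid_time_real_le (m : nat) (T : R) :
  m%:R ^+ 2 * Num.sqrt m%:R <= T -> (avoid_time m + 2)%:R <= 2000 * (T + 1).
Proof.
move=> leT; have := ler_wpM2l (exprn_ge0 2 (ler0n R m)) (ceil_sqrt_le m).
have -> : (avoid_time m + 2)%:R = 1000 * (m%:R ^+ 2 * (ceil_sqrt m)%:R) + 102 :> R.
  by rewrite /avoid_time -addnA natrD !natrM expr2.
move: (m%:R ^+ 2) (Num.sqrt _) (ceil_sqrt m)%:R leT => a b c leT le_c; lra.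
Qed.

Lemma listing_time_real_le (m : nat) (T : R) :
  m%:R ^+ 3 * Num.sqrt m%:R <= T -> (listing_time m)%:R <= 2440 * (T + 1).
Proof.
move=> leT; have := ler_wpM2l (exprn_ge0 3 (ler0n R m)) (ceil_sqrt_le m).
have : (listing_time m)%:R <= 1220 * (m%:R ^+ 3 * (ceil_sqrt m)%:R) + 20 :> R.
  apply: le_trans (_ : (1220 * (m * m * m * ceil_sqrt m) + 20)%:R <= _).
    by rewrite ler_nat listing_time_le.
  by rewrite natrD !natrM !exprS expr0 mulr1 !mulrA.
move: (m%:R ^+ 3) (Num.sqrt _) (ceil_sqrt m)%:R leT => a b c leT le1 le2; lra.
Qed.

End RealBounds.

Lemma decides_of_bound (R : realType) (T : nat -> nat -> R) :
  (forall m n : nat, m%:R ^+ 2 * Num.sqrt m%:R <= T m n) ->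
  exists p, decides_avoidable_in T p.
Proof.
move=> leT; exists Decide, 2000 => B m l M x le_ml M_pref.
have [t [s [ex le_t ans]]] := decide_correct x le_ml M_pref.
exists t, s; split=> //; apply: le_trans (avoid_time_real_le (leT m #|B|)).
by rewrite ler_nat.
Qed.

Lemma lists_of_bound (R : realType) (T : nat -> nat -> R) :
  (forall m n : nat, (0 < m -> m <= n)%N -> m%:R ^+ 3 * Num.sqrt m%:R <= T m n) ->
  exists p, lists_unavoidable_in T p.
Proof.
move=> leT; exists Listing, 2440 => B m l M le_ml M_pref.
have [t [s [ex le_t out]]] := listing_correct le_ml M_pref.
exists t, s; split=> //.
apply: le_trans (listing_time_real_le (leT m #|B| (elements_ge le_ml M_pref))).
by rewrite ler_nat.
Qed.

Theorem corollary5 (R : realType) :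
  ((exists p : program,
      decides_avoidable_in
        (fun m n : nat => m%:R ^+ 2 * Num.sqrt (m + n)%:R : R) p) /\
   (exists p : program,
      decides_avoidable_in (fun m n : nat => m%:R ^+ 3 : R) p)) /\
  ((exists p : program,
      lists_unavoidable_in
        (fun m n : nat => m%:R ^+ 2 * n%:R * Num.sqrt (m + n)%:R : R) p) /\
   (exists p : program,
      lists_unavoidable_in (fun m n : nat => m%:R ^+ 5 : R) p)).
Proof.
have sqrt_add (m n : nat) : Num.sqrt m%:R <= Num.sqrt (m + n)%:R :> R.
  by rewrite ler_wsqrtr // ler_nat leq_addr.
split; split.
- by apply: decides_of_bound => m n; rewrite ler_wpM2l // exprn_ge0.
- apply: decides_of_bound => m n.
  by rewrite [leRHS]exprSr ler_wpM2l ?sqrt_nat_le // exprn_ge0.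
(* Both sides vanish when there is no row; otherwise one factor of [m^3] is replaced by [n]. *)
- apply: lists_of_bound => -[|m] n le_mn; first by rewrite !expr0n !mul0r.
  rewrite exprSr ler_pM ?mulr_ge0 ?exprn_ge0 ?sqrtr_ge0 //.
  by rewrite ler_wpM2l ?exprn_ge0 // ler_nat le_mn.
(* After cancelling the cube it remains to bound the square root of [m] by [m], and [m] by its
   square. *)
apply: lists_of_bound => m n _; rewrite (exprD _ 3 2) ler_wpM2l ?exprn_ge0 //.
apply: le_trans (sqrt_nat_le R m) _.
by rewrite -natrX ler_nat expnS expn1; nia.
Qed.
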